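(* Let $X,Y$ be Banach spaces, $M$ a $\sigma$-bounded family of positive measures on a $\sigma$-algebra $\Sigma$ of subsets of a nonempty set $T$ which is relatively weakly compact in $ca(\Sigma)$, and $\theta,\phi$ conjugate Young's functions. If $\mu_\infty:\Sigma\to L(X,Y)$ is a countably additive measure with $\|\mu_\infty\|_{\theta,M}(T)<\infty$, and $\Delta:\mathcal{H}^\theta(M,X)\to Y$ is defined by $\Delta f=H\int_Tf\,d\mu_\infty$ for $f\in\mathcal{H}^\theta(M,X)$, then $\Delta$ is a continuous linear operator.
   Context: $L(X,Y)$ is the space of bounded linear operators from $X$ to $Y$ with operator norm; $ca(\Sigma)$ is the Banach space of countably additive scalar measures on $\Sigma$ (total variation norm). Write $M(E)=\sup_{\mu\in M}\mu(E)$ for $E\in\Sigma$. $M$ is $\sigma$-bounded: every $E\in\Sigma$ is a union of a pairwise disjoint sequence $E_i\in\Sigma$ with $M(E_i)<\infty$. A property holds $M$-a.e. if it holds outside a set $N\in\Sigma$ with $M(N)=0$. $\mathcal{S}_X(\Sigma)$ is the set of $X$-valued $\Sigma$-simple functions and $\mathcal{S}(\Sigma)$ the set of scalar $\Sigma$-simple functions. $f:T\to X$ is $M$-measurable if some sequence in $\mathcal{S}_X(\Sigma)$ converges to $f$ $M$-a.e. Functions equal $M$-a.e. are identified. Conjugate Young's functions: let $\chi:[0,\infty]\to[0,\infty]$ be nondecreasing and left continuous with $\chi(0)=0$; define $\xi(0)=0$, $\xi(v)=\sup\{u:\chi(u)<v\}$ (so if $\lim_{u\to\infty}\chi(u)=A<\infty$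 then $\xi(v)=\infty$ for $v>A$); then $\theta(u)=\int_0^u\chi(t)\,dt$ and $\phi(v)=\int_0^v\xi(t)\,dt$. $H\int$ denotes the Henstock-Kurzweil integral; for nonnegative measurable functions it is the Lebesgue integral. For measurable $g$ (scalar or $X$-valued), $M_\phi(g)=\sup_{\mu\in M}H\int_T\phi(\|g\|)\,d\mu$ and $M_\theta(g)=\sup_{\mu\in M}H\int_T\theta(\|g\|)\,d\mu$. For $M$-measurable $f:T\to X$, $$\|f\|_{\theta,M}=\sup_{\mu\in M}\ \sup\Big\{H\int_T\|fg\|\,d\mu:\ g\in\mathcal{S}(\Sigma),\ M_\phi(g)\le1\Big\}.$$ $\mathcal{H}^\theta(M,X)$ is the space of all $M$-measurable $f:T\to X$ with $\|f\|_{\theta,M}<\infty$, with the norm $\|\cdot\|_{\theta,M}$. The $(\theta,M)$-semivariation of $\mu_\infty$ is $\|\mu_\infty\|_{\theta,M}(E)=\sup\big\|\sum_{i=1}^n\mu_\infty(E_i)x_i\big\|$ for $E\in\Sigma$, the supremum taken over all simple functions $f=\sum_{i=1}^nx_i\,ch(E_i)\in\mathcal{S}_X(\Sigma)$ with pairwise disjoint $E_i\subset E$ and $M_\theta(f)\le1$, where $ch(E)$ is the characteristic function of $E$. Integral with respect to $\mu_\infty:\Sigma\to L(X,Y)$: for $y_1\in Y'$, $\mu_{\infty_{y_1}}:\Sigma\to X'$ is $\mu_{\infty_{y_1}}(E)x=y_1(\mu_\infty(E)x)$, with variation $|\mu_{\infty_{y_1}}|$, and $\mu_{\infty_{X,Y}}(f)=\sup_{\|y_1\|\le1}H\int_T\|f\|\,d|\mu_{\infty_{y_1}}|$.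 For simple $f=\sum_{i=1}^nx_i\,ch(E_i)$ with disjoint $E_i\in\Sigma$, $H\int_Tf\,d\mu_\infty=\sum_{i=1}^n\mu_\infty(E_i)x_i$. A function $f$ is $\mu_\infty$-integrable if there are simple $f_n$ with $\mu_{\infty_{X,Y}}(f_n-f)\to0$ and $f_n\to f$ $\mu_{\infty_{X,Y}}$-a.e. (i.e. off a set that is $|\mu_{\infty_{y_1}}|$-null for every $y_1$), and then $H\int_Tf\,d\mu_\infty=\lim_nH\int_Tf_n\,d\mu_\infty$.
   Formalization: The formal theorem assumes that every f in H^θ(M,X) is μ_∞-integrable, so that Δ is defined on all of H^θ(M,X); this does not follow from the other hypotheses (it fails for some L(ℓ²,c₀)-valued μ_∞ with θ giving L^∞). *)

(* Defs.v *)
From HB Require Import structures.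
From mathcomp Require Import all_boot all_order all_algebra.
From mathcomp Require Import all_classical all_reals all_analysis.
From mathcomp Require Import complex.

Set Implicit Arguments.
Unset Strict Implicit.
Unset Printing Implicit Defensive.

Import Order.TTheory GRing.Theory Num.Theory.
Import numFieldTopology.Exports numFieldNormedType.Exports.

Local Open Scope classical_set_scope.
Local Open Scope ring_scope.

(* Banach spaces and scalar measures are over R or over C = R[i]. *)
Variant scalar_kind := RealScalars | ComplexScalars.

Definition scalar_field (R : realType) (k : scalar_kind) : numFieldType :=
  match k with RealScalars => R | ComplexScalars => R[i] end.

Definition scalar_re (R : realType) (k : scalar_kind) : scalar_field R k -> R :=
  match k return scalar_field R k -> R with
  | RealScalars => fun x => x
  | ComplexScalars => fun z => complex.Re z
  end.

Definition scalar_of (R : realType) (k : scalar_kind) : R -> scalar_field R k :=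
  match k return R -> scalar_field R k with
  | RealScalars => fun x => x
  | ComplexScalars => fun x => Complex x 0
  end.

(* In MathComp the norm of a normed module over K takes its values in K; when
   K = R[i] it is a complex number with zero imaginary part. [rnorm] is the
   same norm with values in R. *)
Definition rnorm (R : realType) (k : scalar_kind)
    (V : normedModType (scalar_field R k)) (v : V) : R := scalar_re `|v|.

Definition opnorm (R : realType) (k : scalar_kind)
    (X Y : normedModType (scalar_field R k)) (A : X -> Y) : \bar R :=
  ereal_sup [set (rnorm (A x))%:E | x in [set x : X | rnorm x <= 1]].

Section simple_functions.
Context (d : measure_display) (T : measurableType d) (K : numFieldType).

(* A representation sum_i x_i ch(E_i) of a simple function, with pairwise
   disjoint E_i in Sigma; the E_i need not cover T. *)
Record simple (V : lmodType K) := Simple {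
  simple_size : nat;
  simple_set : 'I_simple_size -> set T;
  simple_val : 'I_simple_size -> V;
  simple_measurable : forall i, measurable (simple_set i);
  simple_disjoint : trivIset setT simple_set }.
Arguments simple_set {V} s i.
Arguments simple_val {V} s i.

Definition simple_fun (V : lmodType K) (s : simple V) : T -> V :=
  fun t => \sum_(i < simple_size s) (\1_(simple_set s i) t : K) *: simple_val s i.

Definition simple_int (V W : lmodType K) (mu : set T -> {linear V -> W})
    (s : simple V) : W :=
  \sum_(i < simple_size s) mu (simple_set s i) (simple_val s i).

End simple_functions.

Arguments simple_set {d T K V} s i.
Arguments simple_val {d T K V} s i.

Coercion simple_fun : simple >-> Funclass.

Section variation.
Context (d : measure_display) (T : measurableType d) (R : realType).

(* The variation of a vector measure whose values have norms [N A]. *)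
Definition variation (N : set T -> \bar R) (E : set T) : \bar R :=
  ereal_sup [set v | exists n (F : 'I_n -> set T),
    [/\ forall i, measurable (F i), trivIset setT F,
        forall i, F i `<=` E & v = (\sum_(i < n) N (F i))%E]].

End variation.

Section ca.
Context (d : measure_display) (T : measurableType d) (R : realType)
  (k : scalar_kind).
Local Notation K := (scalar_field R k).

(* Set functions are total in Rocq: requiring the value 0 off Sigma makes
   elements of ca(Sigma) equal as soon as they agree on Sigma. *)
Definition countably_additive (nu : set T -> K) : Prop :=
  (forall A, ~ measurable A -> nu A = 0) /\
  forall F : nat -> set T, (forall i, measurable (F i)) -> trivIset setT F ->
    (\sum_(0 <= i < n) nu (F i)) @[n --> \oo] --> nu (\bigcup_i F i).

Definition ca_pred : {pred set T -> K} := fun nu => `[< countably_additive nu >].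

Lemma ca_submod_closed : submod_closed ca_pred.
Proof.
split.
  apply/asboolP; split => // F mF tF.
  rewrite [X in X @ _ --> _](_ : _ = fun=> 0); first exact: cvg_cst.
  by apply/funext => n; rewrite big1.
move=> a u v /asboolP[u0 uF] /asboolP[v0 vF]; apply/asboolP; split=> [A nA|F mF tF].
  by rewrite !fctE u0// v0// scaler0 addr0.
rewrite [X in X @ _ --> _](_ : _ = fun n => a * (\sum_(0 <= i < n) u (F i)) +
    \sum_(0 <= i < n) v (F i)); last first.
  by apply/funext => n; rewrite mulr_sumr -big_split.
by apply: cvgD; [apply: cvgM; [exact: cvg_cst|exact: uF]|exact: vF].
Qed.

HB.instance Definition _ :=
  GRing.isSubmodClosed.Build K (set T -> K) ca_pred ca_submod_closed.

Record ca := CA { ca_val :> set T -> K; ca_valP : ca_val \in ca_pred }.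

HB.instance Definition _ := [isSub for ca_val].
HB.instance Definition _ := [Choice of ca by <:].
HB.instance Definition _ := [SubChoice_isSubLmodule of ca by <:].

Definition ca_norm (nu : ca) : \bar R :=
  variation (fun A => (rnorm (nu A : K^o))%:E) setT.

Definition ca_functional_bounded (L : ca -> K) : Prop :=
  exists C : R, forall nu : ca, ((rnorm (L nu : K^o))%:E <= C%:E * ca_norm nu)%E.

Record ca_dual := CADual {
  ca_functional :> {linear ca -> K^o};
  ca_functionalP : ca_functional_bounded ca_functional }.

Definition ca_eval (nu : ca) : prod_topology (fun _ : ca_dual => K) :=
  fun L => L nu.

Definition weak_ca : topologicalType := initial_topology ca_eval.

Definition relatively_weakly_compact (A : set ca) : Prop :=
  compact (closure (A : set weak_ca)).

Definition measure_fun (mu : {finite_measure set T -> \bar R}) : set T -> K :=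
  fun A => if `[< measurable A >] then scalar_of k (fine (mu A)) else 0.

Lemma measure_fun_ca (mu : {finite_measure set T -> \bar R}) :
  measure_fun mu \in ca_pred.
Proof.
apply/asboolP; split=> [A nA|F mF tF]; rewrite /measure_fun.
  by case: asboolP.
rewrite asboolT; last exact: bigcup_measurable.
rewrite [X in X @ _ --> _](_ : _ = fun n =>
    scalar_of k (fine (\sum_(0 <= i < n) mu (F i))%E)); last first.
  apply/funext => n; rewrite -sum_fine; last by move=> i _; exact: fin_num_measure.
  have scalar0 : scalar_of k 0 = 0 :> K by case: (k).
  have scalarD : {morph @scalar_of R k : x y / x + y}.
    by case: (k) => //= x y; apply/eqP; rewrite eq_complex/= addr0 !eqxx.
  rewrite (big_morph _ scalarD scalar0); apply: eq_bigr => i _.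
  by rewrite asboolT.
have cF : fine (\sum_(0 <= i < n) mu (F i))%E @[n --> \oo] -->
    fine (mu (\bigcup_i F i)).
  apply: fine_cvg; rewrite fineK; last first.
    by apply: fin_num_measure; exact: bigcup_measurable.
  by apply: measure_semi_sigma_additive => //; exact: bigcup_measurable.
case: (k); first exact: cF.
apply/(@cvgrPdist_lt R[i] R[i]^o) => e e0.
have [e1 ei] : (0 < complex.Re e /\ e = Complex (complex.Re e) 0).
  by case: e e0 => a b; rewrite ltcE/= => /andP[/eqP -> ?].
move/cvgrPdist_lt : cF => /(_ _ e1); apply: filterS => n.
rewrite ei (_ : _ - _ = Complex (fine (mu (\bigcup_i F i)) -
    fine (\sum_(0 <= i < n) mu (F i))%E) 0); last first.
  by apply/eqP; rewrite eq_complex/= subr0 !eqxx.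
by rewrite normc_def/= expr0n/= addr0 sqrtr_sqr ltcR.
Qed.

Definition measure_ca (mu : {finite_measure set T -> \bar R}) : ca :=
  CA (measure_fun_ca mu).

End ca.

Section young.
Context (R : realType).
Local Open Scope ereal_scope.

Definition young_density (chi : \bar R -> \bar R) : Prop :=
  [/\ chi 0 = 0,
      forall u, 0 <= u -> 0 <= chi u,
      forall u v, 0 <= u -> u <= v -> chi u <= chi v &
      forall u, 0 < u -> chi t @[t --> within [set t | 0 <= t < u] (nbhs u)]
        --> chi u].

Definition young_inverse (chi : \bar R -> \bar R) (v : \bar R) : \bar R :=
  if v == 0 then 0 else ereal_sup [set u | 0 <= u /\ chi u < v].

Definition young_primitive (chi : \bar R -> \bar R) (u : \bar R) : \bar R :=
  \int[lebesgue_measure]_(t in [set t : R | 0 <= t%:E <= u]) chi t%:E.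

Definition conjugate_young (theta phi : \bar R -> \bar R) : Prop :=
  exists chi, [/\ young_density chi,
    forall u, 0 <= u -> theta u = young_primitive chi u &
    forall v, 0 <= v -> phi v = young_primitive (young_inverse chi) v].

End young.

Section family.
Context (d : measure_display) (T : measurableType d) (R : realType)
  (k : scalar_kind).
Local Notation K := (scalar_field R k).
Variable M : set {finite_measure set T -> \bar R}.

(* Suprema over M are suprema in [0, +oo], so that they are 0 for empty M. *)
Definition sup_over (F : {finite_measure set T -> \bar R} -> \bar R) : \bar R :=
  ereal_sup (0%E |` [set F mu | mu in M]).

Definition family_measure (E : set T) : \bar R := sup_over (fun mu => mu E).

Definition sigma_bounded : Prop :=
  forall E, measurable E -> exists F : nat -> set T,
    [/\ forall i, measurable (F i), trivIset setT F, E = \bigcup_i F i &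
        forall i, (family_measure (F i) < +oo)%E].

Definition family_ae (P : T -> Prop) : Prop :=
  exists N, [/\ measurable N, family_measure N = 0%E & forall t, ~ N t -> P t].

Definition family_measurable (V : normedModType K) (f : T -> V) : Prop :=
  exists s : nat -> simple T V,
    family_ae (fun t => s n t @[n --> \oo] --> f t).

(* Library integrals of nonnegative functions are suprema over nonnegative
   simple minorants: they need no measurability, and for a function that is
   only measurable off a null set they give the Lebesgue integral of any
   measurable modification. *)
Definition modular (young : \bar R -> \bar R) (V : normedModType K)
    (f : T -> V) : \bar R :=
  sup_over (fun mu => \int[mu]_t young (rnorm (f t))%:E)%E.

(* ||f||_{theta, M}, which depends on theta through its conjugate phi only. *)
Definition orlicz_norm (phi : \bar R -> \bar R) (X : normedModType K)
    (f : T -> X) : \bar R :=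
  sup_over (fun mu =>
    ereal_sup [set (\int[mu]_t (rnorm (g t *: f t))%:E)%E |
      g in [set g : simple T K^o | (modular phi g <= 1)%E]]).

Definition Htheta (phi : \bar R -> \bar R) (X : normedModType K)
    : set (T -> X) :=
  [set f | family_measurable f /\ (orlicz_norm phi f < +oo)%E].

Definition semivariation (theta : \bar R -> \bar R) (X Y : normedModType K)
    (mu : set T -> {linear X -> Y}) (E : set T) : \bar R :=
  ereal_sup [set (rnorm (simple_int mu s))%:E |
    s in [set s : simple T X | (forall i, simple_set s i `<=` E) /\
                               (modular theta s <= 1)%E]].

End family.

Section operator_measure.
Context (d : measure_display) (T : measurableType d) (R : realType)
  (k : scalar_kind) (X Y : normedModType (scalar_field R k)).
Local Notation K := (scalar_field R k).

(* Only the values of mu on Sigma matter: they are in L(X, Y), and mu is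
   countably additive there for the operator norm. *)
Definition operator_measure (mu : set T -> {linear X -> Y}) : Prop :=
  (forall E, measurable E -> continuous (mu E)) /\
  forall F : nat -> set T, (forall i, measurable (F i)) -> trivIset setT F ->
    opnorm (fun x => \sum_(0 <= i < n) mu (F i) x - mu (\bigcup_i F i) x)
      @[n --> \oo] --> 0%E.

Variable mu : set T -> {linear X -> Y}.

Definition dual_variation (y1 : {linear Y -> K^o}) : set T -> \bar R :=
  variation (fun E => opnorm (fun x : X => y1 (mu E x))).

Definition mu_XY (f : T -> X) : \bar R :=
  ereal_sup [set (\int[dual_variation y1]_t (rnorm (f t))%:E)%E |
    y1 in [set y1 : {linear Y -> K^o} | continuous y1 /\ (opnorm y1 <= 1)%E]].

Definition mu_ae (P : T -> Prop) : Prop :=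
  exists N, [/\ measurable N,
    forall y1 : {linear Y -> K^o}, continuous y1 -> dual_variation y1 N = 0%E &
    forall t, ~ N t -> P t].

Definition integrating_sequence (f : T -> X) (s : nat -> simple T X) : Prop :=
  mu_XY (fun t => s n t - f t) @[n --> \oo] --> 0%E /\
  mu_ae (fun t => s n t @[n --> \oo] --> f t).

Definition has_integral (f : T -> X) (y : Y) : Prop :=
  exists2 s, integrating_sequence f s &
    simple_int mu (s n) @[n --> \oo] --> y.

End operator_measure.

(* Main.v *)
(* For a functional [y1] on [Y], the set function [E |-> y1 o mu E] has a
   variation [|mu_y1|] that is a measure, and [|y1 (int s)| <= int |s| d|mu_y1|]
   for simple [s]. By Hahn-Banach the integral of [f] is therefore determined by
   the seminorm [mu_XY], which gives linearity, invariance under changes on null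
   sets, and [|Delta f| <= mu_XY f]. It remains to bound [mu_XY f] by the Orlicz
   norm. Up to a supremum, [int |f| d|mu_y1|] is [y1 (int s)] for a simple [s]
   with [|s| <= |f|], so that finiteness of the semivariation reduces the bound
   to the implication: if the Orlicz norm of [s] is at most [l], then
   [M_theta (s / 2l) <= 1]. For this one tests the norm against functions
   [g <= chi (|s| / 2l)] on sets of finite [M]-measure: there
   [phi g <= g |s| / 2l], so [g] is admissible, and
   [theta u <= u chi u] concludes. *)

From HB Require Import structures.
From mathcomp Require Import all_boot all_order all_algebra finmap.
From mathcomp Require Import all_classical all_reals all_analysis.
From mathcomp Require Import complex measurable_realfun ring lra.
Require Import Defs.

Set Implicit Arguments.
Unset Strict Implicit.
Unset Printing Implicit Defensive.

Import Order.TTheory GRing.Theory Num.Theory.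
Import HBNNSimple.
Import numFieldTopology.Exports numFieldNormedType.Exports.

Local Open Scope classical_set_scope.
Local Open Scope ring_scope.

(** * The norm with real values *)

(** The modular [M_phi] is a supremum over all of [M], so a test function has to be normalised for
    every measure at once, while the wanted estimate concerns each measure separately. Let P be the
    modular of a candidate [c]. Dividing [c] by P requires P to be finite, which is why the tests
    live on sets of finite [M]-measure. The factor 2 in [s / 2l] rules out P > 1: the test then
    yields P <= P / 2, impossible for a finite positive P. Since [chi] may reach [+oo] while a test
    function has finite values, only finite values below [chi] are tested, and a supremum recovers
    [chi]. A second obstacle is measurability: [X] carries no sigma-algebra, and the norm of [f] is
    a limit of measurable functions only off a null set. Upper bounds therefore go through simple
    minorants, and additivity of the integral is invoked only off null sets. Real and complex
    scalars are treated together: Hahn-Banach is proved for real-linear functionals and complexified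
    at the end. *)

Section scalars.
Context (R : realType) (k : scalar_kind).
Local Notation K := (scalar_field R k).
Implicit Types (a b : R) (z : K).

Lemma scalar_of0 : scalar_of k 0 = 0 :> K.
Proof. by case: (k). Qed.

Lemma scalar_of1 : scalar_of k 1 = 1 :> K.
Proof. by case: (k). Qed.

Lemma scalar_ofD a b : scalar_of k (a + b) = scalar_of k a + scalar_of k b.
Proof.
by case: (k) => //=; apply/eqP; rewrite eq_complex/= addr0 !eqxx.
Qed.

Lemma scalar_ofM a b : scalar_of k (a * b) = scalar_of k a * scalar_of k b.
Proof.
case: (k) => //=; apply/eqP; rewrite eq_complex/=.
by rewrite !mulr0 mul0r subr0 addr0 !eqxx.
Qed.

Lemma scalar_ofN a : scalar_of k (- a) = - scalar_of k a.
Proof. by case: (k) => //=; apply/eqP; rewrite eq_complex/= oppr0 !eqxx. Qed.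

Lemma scalar_ofK a : scalar_re (scalar_of k a) = a.
Proof. by case: (k). Qed.

Lemma ge0_scalar_reK z : 0 <= z -> scalar_of k (scalar_re z) = z.
Proof.
by move: z; case: (k) => //= -[a b]; rewrite lecE/= => /andP[/eqP-> _].
Qed.

Lemma scalar_le a b : (scalar_of k a <= scalar_of k b) = (a <= b).
Proof. by case: (k) => //=; rewrite lecE/= eqxx. Qed.

Lemma scalar_lt a b : (scalar_of k a < scalar_of k b) = (a < b).
Proof. by case: (k) => //=; rewrite ltcE/= eqxx. Qed.

Lemma scalar_gt0 z : 0 < z -> exists2 e : R, 0 < e & z = scalar_of k e.
Proof.
move=> z0; exists (scalar_re z); last by rewrite ge0_scalar_reK// ltW.
by rewrite -scalar_lt scalar_of0 ge0_scalar_reK// ltW.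
Qed.

Lemma scalar_norm a : `|scalar_of k a| = scalar_of k `|a|.
Proof.
by case: (k) => //=; rewrite normc_def/= expr0n/= addr0 sqrtr_sqr.
Qed.

Lemma rnormE (V : normedModType K) (v : V) : scalar_of k (rnorm v) = `|v|.
Proof. by rewrite ge0_scalar_reK. Qed.

Lemma rnorm_scalar_of a : rnorm (scalar_of k a : K^o) = `|a|.
Proof. by rewrite /rnorm scalar_norm scalar_ofK. Qed.

Section rnorm.
Context (V : normedModType K).
Implicit Types v w : V.

Lemma rnorm_ge0 v : 0 <= rnorm v.
Proof. by rewrite -scalar_le scalar_of0 rnormE. Qed.

Lemma rnorm0 : rnorm (0 : V) = 0.
Proof. by rewrite /rnorm normr0 -scalar_of0 scalar_ofK. Qed.

Lemma rnorm_eq0 v : rnorm v = 0 -> v = 0.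
Proof. by move=> v0; apply/normr0_eq0; rewrite -rnormE v0 scalar_of0. Qed.

Lemma ler_rnormD v w : rnorm (v + w) <= rnorm v + rnorm w.
Proof. by rewrite -scalar_le scalar_ofD !rnormE ler_normD. Qed.

Lemma rnormN v : rnorm (- v) = rnorm v.
Proof. by rewrite /rnorm normrN. Qed.

Lemma rnormBC v w : rnorm (v - w) = rnorm (w - v).
Proof. by rewrite -rnormN opprB. Qed.

Lemma rnormZ z v : rnorm (z *: v) = rnorm (z : K^o) * rnorm v.
Proof.
apply: (can_inj scalar_ofK); rewrite scalar_ofM !rnormE.
exact: normrZ.
Qed.

Lemma rnormZr a v : rnorm (scalar_of k a *: v) = `|a| * rnorm v.
Proof. by rewrite rnormZ rnorm_scalar_of. Qed.

Lemma rnorm_sum I (r : seq I) (P : pred I) (F : I -> V) :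
  rnorm (\sum_(i <- r | P i) F i) <= \sum_(i <- r | P i) rnorm (F i).
Proof.
elim/big_rec2: _ => [|i y x _ le_xy]; first by rewrite rnorm0.
by rewrite (le_trans (ler_rnormD _ _))// lerD2l.
Qed.

Lemma ler_dist_rnorm v w : `|rnorm v - rnorm w| <= rnorm (v - w).
Proof.
have tri v' w' : rnorm v' - rnorm w' <= rnorm (v' - w').
  by rewrite lerBlDr -{1}(subrK w' v') ler_rnormD.
by rewrite ler_norml tri andbT lerNl opprB rnormBC tri.
Qed.

Lemma cvg_rnormP (s : nat -> V) v :
  s n @[n --> \oo] --> v <-> rnorm (s n - v) @[n --> \oo] --> (0 : R).
Proof.
split=> [/cvgrPdist_lt sv|/cvgrPdist_lt sv].
  apply/cvgrPdist_lt => e e0.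
  have {}e0 : 0 < scalar_of k e by rewrite -scalar_of0 scalar_lt.
  move: (sv _ e0); apply: filterS => n.
  rewrite -rnormE scalar_lt sub0r normrN rnormBC ger0_norm//.
  exact: rnorm_ge0.
apply/cvgrPdist_lt => _ /scalar_gt0[e e0 ->].
move: (sv _ e0); apply: filterS => n.
rewrite sub0r normrN ger0_norm ?rnorm_ge0// => ?.
by rewrite -rnormE scalar_lt rnormBC.
Qed.

Lemma cvg_rnorm (s : nat -> V) v :
  s n @[n --> \oo] --> v -> rnorm (s n) @[n --> \oo] --> rnorm v.
Proof.
move=> /cvg_rnormP/cvgrPdist_lt sv; apply/cvgrPdist_lt => e e0.
move: (sv _ e0); apply: filterS => n.
rewrite sub0r normrN ger0_norm ?rnorm_ge0//; apply: le_lt_trans.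
by rewrite rnormBC ler_dist_rnorm.
Qed.

End rnorm.

Lemma ler_scalar_re z : scalar_re z <= rnorm (z : K^o).
Proof.
rewrite /rnorm; move: z; case: (k) => /= [z|z]; first exact: ler_norm.
apply: le_trans (ler_norm _) _; move: (normc_ge_Re z).
by rewrite lecE/= => /andP[].
Qed.

(** Rotation by [c] serves twice: to turn a bound on real parts into a bound on norms, and to make
    finitely many scalars add up without cancellation. *)
Lemma phase z : exists c : K,
  rnorm (c : K^o) = 1 /\ c * z = scalar_of k (rnorm (z : K^o)).
Proof.
have [->|z0] := eqVneq z 0.
  exists 1; rewrite mulr0 (rnorm0 (K^o : normedModType K)) scalar_of0; split=> //.
  by rewrite -scalar_of1 rnorm_scalar_of normr1.
exists (`|z| / z); rewrite (@rnormE K^o z) divfK//; split=> //.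
rewrite /rnorm normrM normrV ?unitfE// normr_id mulfV ?normr_eq0//.
by rewrite -scalar_of1 scalar_ofK.
Qed.

End scalars.

(** * Hahn-Banach *)

Section hahn_banach.
Context (R : realType) (k : scalar_kind) (V : normedModType (scalar_field R k)).
Local Notation K := (scalar_field R k).
Local Notation "a **: v" := (scalar_of k a *: v) (at level 40).

(* A subset of V * R that is a real subspace lying below the norm is the graph
   of a real linear functional on a subspace. *)
Let dominated (G : set (V * R)) :=
  (forall a p q, G p -> G q -> G (a **: p.1 + q.1, a * p.2 + q.2)) /\
  (forall p, G p -> p.2 <= rnorm p.1).

Let line v : set (V * R) := [set (a **: v, a * rnorm v) | a in setT].

Let dominated_line v : dominated (line v).
Proof.
split=> [a _ _ [b _ <-] [c _ <-]/=|_ [a _ <-]/=].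
  exists (a * b + c) => //.
  by rewrite scalar_ofD scalar_ofM scalerDl scalerA mulrDl mulrA.
by rewrite rnormZr ler_wpM2r ?rnorm_ge0// ler_norm.
Qed.

(** Zorn's lemma also asks for the union of the empty chain, which is empty. Applying it to the sets
    that become dominated once [line v] is adjoined makes that union admissible. *)
Let dominated_maximal v : exists G : set (V * R),
  [/\ dominated G, line v `<=` G &
      forall H, dominated H -> G `<=` H -> H `<=` G].
Proof.
have [F FP totF|A [Ag Amax]] :=
    @Zorn_bigcup (V * R) [set A | dominated (A `|` line v)].
  have union2 p q : (\bigcup_(X in F) X `|` line v) p ->
      (\bigcup_(X in F) X `|` line v) q ->
    exists A, [/\ dominated A, A `<=` \bigcup_(X in F) X `|` line v, A p & A q].
    have sub A : F A -> A `|` line v `<=` \bigcup_(X in F) X `|` line v.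
      by move=> FA x [Ax|]; [left; exists A|right].
    move=> [[A FA Ap]|lp] [[B FB Bq]|lq].
    - have [AB|BA] := totF _ _ FA FB.
        by exists (B `|` line v); split; [exact: FP|exact: sub|left; exact: AB|left].
      by exists (A `|` line v); split; [exact: FP|exact: sub|left|left; exact: BA].
    - by exists (A `|` line v); split; [exact: FP|exact: sub|left|right].
    - by exists (B `|` line v); split; [exact: FP|exact: sub|right|left].
    - by exists (line v); split=> //; exact: dominated_line.
  split=> [a p q Fp Fq|p Fp].
    by have [A [[Al _] As Ap Aq]] := union2 _ _ Fp Fq; apply/As/Al.
  by have [A [[_ Ad] _ Ap _]] := union2 _ _ Fp Fp; exact: Ad.
exists (A `|` line v); split; [exact: Ag|by right|move=> H Hg AH p Hp].
apply: contrapT => nAp; apply: (Amax H); last first.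
  rewrite /= (_ : H `|` line v = H)//.
  by apply/setUidPl => q lq; apply: AH; right.
by split=> [q Aq|HA]; [apply: AH; left|apply: nAp; left; exact: HA].
Qed.

(** One-dimensional extension: a value [c] at [v] is compatible with domination when it lies above
    every [p.2 - rnorm (p.1 - v)] and below every [rnorm (q.1 + v) - q.2]. The triangle inequality
    leaves room for such a [c], and maximality puts the extended graph [H] inside [G]. *)
Let dominated_total G : dominated G -> G !=set0 ->
  (forall H, dominated H -> G `<=` H -> H `<=` G) ->
  forall v, exists r, G (v, r).
Proof.
move=> [Gl Gd] [p0 Gp0] Gmax v.
have G0 : G (0, 0).
  by have := Gl (-1) _ _ Gp0 Gp0; rewrite scalar_ofN scalar_of1 scaleN1r mulN1r !addNr.
pose L := [set p.2 - rnorm (p.1 - v) | p in G].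
have Lub q : G q -> ubound L (rnorm (q.1 + v) - q.2).
  move=> Gq _ [p Gp <-]; rewrite lerBlDr addrAC lerBrDr.
  have := Gl 1 _ _ Gp Gq; rewrite scalar_of1 scale1r mul1r => /Gd /= /le_trans; apply.
  rewrite (_ : p.1 + q.1 = (p.1 - v) + (q.1 + v)); last first.
    by rewrite addrACA addNr addr0.
  by rewrite [leRHS]addrC ler_rnormD.
pose c := sup L.
have supL : has_sup L.
  split; first by exists (0 - rnorm (0 - v)); exists (0, 0).
  by exists (rnorm (0 + v) - 0); exact: Lub G0.
have cl q : G q -> c <= rnorm (q.1 + v) - q.2.
  by move=> Gq; apply: ge_sup => //; [case: supL|exact: Lub].
have cu q : G q -> q.2 - rnorm (q.1 - v) <= c.
  by move=> Gq; apply: (sup_upper_bound supL); exists q.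
pose H := [set p | exists q a, [/\ G q, p.1 = q.1 + a **: v & p.2 = q.2 + a * c]].
have Gscale a q : G q -> G (a **: q.1, a * q.2).
  by move=> Gq; have := Gl a _ _ Gq G0; rewrite !addr0.
have dH : dominated H.
  split=> [a p1 p2 [q1 [a1 [Gq1 -> ->]]] [q2 [a2 [Gq2 -> ->]]]|p [q [a [Gq -> ->]]]].
    exists (a **: q1.1 + q2.1, a * q1.2 + q2.2), (a * a1 + a2); split=> /=.
    - exact: Gl.
    - by rewrite scalar_ofD scalar_ofM scalerDl scalerDr scalerA addrACA.
    - by rewrite mulrDl mulrDr addrACA mulrA.
  (* Dividing by the absolute value of [a] reduces the bound to [cu] when [a] is negative and to
     [cl] when it is positive. *)
  have [a0|a0|->] := ltgtP a 0; last by rewrite scalar_of0 scale0r mul0r !addr0; exact: Gd.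
  - have := cu _ (Gscale (- a^-1) q Gq); rewrite /= => cua.
    have -> : q.1 + a **: v = (- a) **: ((- a^-1) **: q.1 - v).
      rewrite scalerBr scalerA -scalar_ofM mulrNN mulfV ?lt_eqF// scalar_of1.
      by rewrite scale1r scalar_ofN scaleNr opprK.
    rewrite rnormZr gtr0_norm ?oppr_gt0//.
    rewrite -ler_pdivrMl ?oppr_gt0// mulrDr invrN mulNr.
    rewrite [X in _ + X]mulrA mulNr mulVf ?lt_eqF// mulN1r.
    by move: cua; rewrite mulNr; lra.
  - have := cl _ (Gscale a^-1 q Gq); rewrite /= => cla.
    have -> : q.1 + a **: v = a **: (a^-1 **: q.1 + v).
      by rewrite scalerDr scalerA -scalar_ofM mulfV ?gt_eqF// scalar_of1 scale1r.
    rewrite rnormZr gtr0_norm//.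
    rewrite -ler_pdivrMl// mulrDr [X in _ + X]mulrA mulVf ?gt_eqF// mul1r.
    by move: cla; lra.
exists c; apply: (Gmax H dH) => [q Gq|].
  by exists q, 0; split=> //; rewrite ?scalar_of0 ?scale0r ?mul0r addr0.
by exists (0, 0), 1; split=> //=; rewrite ?scalar_of1 ?scale1r ?mul1r add0r.
Qed.

Lemma real_hahn_banach v : exists l : V -> R,
  [/\ forall a x y, l (a **: x + y) = a * l x + l y,
      forall x, l x <= rnorm x & l v = rnorm v].
Proof.
have [G [[Gl Gd] lG Gmax]] := dominated_maximal v.
have Gv : G (v, rnorm v) by apply: lG; exists 1; rewrite // scalar_of1 scale1r mul1r.
have /choice[l Gl'] : forall x, exists r, G (x, r).
  by apply: (dominated_total _ _ Gmax) => //; exists (v, rnorm v).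
have G0r r : G (0, r) -> r <= 0.
  by move=> /Gd /=; rewrite rnorm0.
(* Both [r - s] and [s - r] are values of [G] at 0, hence nonpositive: the relation is a
   function. *)
have Guniq x r s : G (x, r) -> G (x, s) -> r = s.
  move=> Gr Gs; apply/eqP; rewrite eq_le; apply/andP; split.
    have := Gl (-1) _ _ Gs Gr; rewrite /= scalar_ofN scalar_of1 scaleN1r addNr.
    by move=> /G0r; rewrite mulN1r addrC subr_le0.
  have := Gl (-1) _ _ Gr Gs; rewrite /= scalar_ofN scalar_of1 scaleN1r addNr.
  by move=> /G0r; rewrite mulN1r addrC subr_le0.
exists l; split=> [a x y|x|]; last exact: Guniq (Gl' v) Gv.
- exact: Guniq (Gl' _) (Gl a _ _ (Gl' x) (Gl' y)).
- exact: Gd (Gl' x).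
Qed.

End hahn_banach.

Lemma norming_linear (R : realType) (k : scalar_kind)
    (V : normedModType (scalar_field R k)) (v : V) :
  exists f : {linear V -> (scalar_field R k)^o},
    scalar_re (f v) = rnorm v /\ forall x, scalar_re (f x) <= rnorm x.
Proof.
have [l [ll ld lv]] := real_hahn_banach v.
case: k V v l ll ld lv => [V v l ll ld lv|V v l ll ld lv].
  pose f : {linear V -> R^o} := HB.pack l (GRing.isLinear.Build _ _ _ _ _ ll).
  by exists f; split.
(* A complex-linear functional is recovered from its real part [l] as [l x - i l (i x)]. *)
pose g (x : V) : R[i]^o := Complex (l x) (- l ('i%C *: x)).
have lD x y : l (x + y) = l x + l y.
  by have := ll 1 x y; rewrite (scalar_of1 R ComplexScalars) scale1r mul1r.
have l0 : l 0 = 0 by have := lD 0 0; rewrite addr0; lra.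
have lZ a x : l (Complex a 0 *: x) = a * l x.
  by have := ll a x 0; rewrite !addr0 l0 addr0.
have gl : linear g.
  move=> [a b] x y; rewrite /g.
  have decomp w : Complex a b *: w = Complex a 0 *: w + Complex b 0 *: ('i%C *: w).
    rewrite scalerA -scalerDl; congr (_ *: _).
    by apply/eqP; rewrite eq_complex /=; apply/andP; split; apply/eqP; ring.
  rewrite scalerDr scalerA (mulrC 'i%C) -scalerA !lD !decomp !lD !lZ.
  rewrite (scalerA 'i%C 'i%C) (_ : 'i%C * 'i%C = Complex (-1) 0); last first.
    by apply/eqP; rewrite eq_complex /=; apply/andP; split; apply/eqP; ring.
  rewrite lZ; apply/eqP; rewrite eq_complex /=.
  by apply/andP; split; apply/eqP; ring.
pose f : {linear V -> R[i]^o} := HB.pack g (GRing.isLinear.Build _ _ _ _ _ gl).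
by exists f; split.
Qed.

Lemma lipschitz_linear_continuous (R : realType) (k : scalar_kind)
    (V W : normedModType (scalar_field R k)) (f : {linear V -> W}) :
  (forall x, rnorm (f x) <= rnorm x) -> continuous f.
Proof.
move=> fle x; apply/cvgrPdist_lt => e e0; near=> y.
rewrite -linearB; have : `|x - y| < e by near: y; exact: cvgr_dist_lt.
by apply: le_lt_trans; rewrite -!rnormE scalar_le.
Unshelve. all: by end_near. Qed.

Lemma norming_functional (R : realType) (k : scalar_kind)
    (V : normedModType (scalar_field R k)) (v : V) :
  exists f : {linear V -> (scalar_field R k)^o},
    [/\ continuous f, (opnorm f <= 1)%E & rnorm v <= rnorm (f v)].
Proof.
have [f [fv fle]] := norming_linear v; exists f.
have fn x : rnorm (f x) <= rnorm x.
  have [c [c1 cfx]] := phase (f x).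
  have cfx' : f (c *: x) = scalar_of k (rnorm (f x)) by rewrite linearZ; exact: cfx.
  by have := fle (c *: x); rewrite cfx' scalar_ofK rnormZ c1 mul1r.
split.
- exact: lipschitz_linear_continuous.
- by apply: ge_ereal_sup => _ [x x1 <-]; rewrite lee_fin (le_trans (fn x)).
- by rewrite -fv ler_scalar_re.
Qed.

(** * Variation of a set function *)

Section sup_sums.
Context (R : realType).
Local Open Scope ereal_scope.

Lemma ereal_sup_add_le (S : set \bar R) (c B : \bar R) :
  (forall v, S v -> 0 <= v) -> 0 <= c -> (forall v, S v -> v + c <= B) ->
  ereal_sup S + c <= B.
Proof.
move=> S0; case: c => [c| |//] c0 SB.
  rewrite -leeBrDr//; apply: ge_ereal_sup => v Sv.
  by rewrite leeBrDr//; exact: SB.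
(* Here [c] is [+oo]. An empty [S] has supremum [-oo], and [-oo + +oo] is [-oo]; a nonempty [S]
   forces [B] to be [+oo]. *)
have [->|/set0P[v Sv]] := eqVneq S set0; first by rewrite ereal_sup0 leNye.
have := SB _ Sv; rewrite addey ?gt_eqF ?(lt_le_trans _ (S0 _ Sv))//.
by rewrite leye_eq => /eqP ->; rewrite leey.
Qed.

(** The choices for different indices are independent, so a sum of suprema is approached by sums of
    chosen elements. This unfolds variations, operator norms and values of [chi] inside finite
    sums. *)
Lemma sum_ereal_sup_le (I : eqType) (r : seq I) (w : I -> R)
    (S : I -> set \bar R) (B : \bar R) :
  uniq r -> (forall i, (0 <= w i)%R) -> (forall i, S i !=set0) ->
  (forall i v, S i v -> 0 <= v) ->
  (forall v : I -> \bar R, (forall i, S i (v i)) ->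
    \sum_(i <- r) (w i)%:E * v i <= B) ->
  \sum_(i <- r) (w i)%:E * ereal_sup (S i) <= B.
Proof.
move=> ur w0 Sn0 S0 SB.
have sup0 i : 0 <= ereal_sup (S i).
  by have [v Sv] := Sn0 i; apply: le_trans (S0 _ _ Sv) (ereal_sup_ubound Sv).
(* The summand [c] collects the terms already chosen, so that the induction deals with one supremum
   at a time. *)
suff gen (c : \bar R) : 0 <= c ->
    (forall v : I -> \bar R, (forall i, S i (v i)) ->
      \sum_(i <- r) (w i)%:E * v i + c <= B) ->
    \sum_(i <- r) (w i)%:E * ereal_sup (S i) + c <= B.
  by rewrite -[leLHS]adde0; apply: gen => // v Sv; rewrite adde0 SB.
elim: r ur {SB} c => [_|i r IH /= /andP[ir ur]] c c0 SB.
  have /choice[v Sv] : forall i, exists v, S i v by move=> i; exact: Sn0.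
  by have := SB v Sv; rewrite !big_nil.
rewrite big_cons -ereal_supZl//; last by apply/set0P; exact: Sn0.
rewrite -addeA; apply: ereal_sup_add_le.
- by move=> _ [v Sv <-]; rewrite mule_ge0 ?lee_fin ?w0//; exact: S0 Sv.
- by rewrite adde_ge0// sume_ge0// => j _; rewrite mule_ge0 ?lee_fin.
- move=> _ [u Su <-]; rewrite addeCA; apply: IH => //.
    by rewrite adde_ge0// mule_ge0 ?lee_fin//; exact: S0 Su.
  move=> v Sv; have := SB (fun j => if j == i then u else v j).
  rewrite big_cons eqxx addeCA addeA (eq_big_seq (fun j => (w j)%:E * v j)).
    by apply => j; case: ifPn => // /eqP ->.
  by move=> j jr /=; case: ifPn => // /eqP ji; move: ir; rewrite -ji jr.
Qed.

End sup_sums.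

Section variation_measure.
Context (d : measure_display) (T : measurableType d) (R : realType).
Variable N : set T -> \bar R.
Local Open Scope ereal_scope.

(** With arbitrary finite index types, two partitions can be joined over a sum type and the empty
    one indexed by [void]. *)
Lemma variation_fin_ub (I : finType) (F : I -> set T) (E : set T) :
  (forall i, measurable (F i)) -> trivIset setT F -> (forall i, F i `<=` E) ->
  \sum_(i : I) N (F i) <= variation N E.
Proof.
move=> mF tF FE; apply: ereal_sup_ubound.
exists #|I|, (fun i => F (enum_val i)); split=> //.
  by move=> i j _ _ /(tF _ _ Logic.I Logic.I)/enum_val_inj.
rewrite (reindex_onto enum_val enum_rank)/=.
  by apply: eq_bigl => i; rewrite enum_valK eqxx.
by move=> i _; rewrite enum_rankK.
Qed.

Lemma variation_mono (A B : set T) : A `<=` B -> variation N A <= variation N B.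
Proof.
move=> AB; apply: ge_ereal_sup => _ [n [F [mF tF FA ->]]].
by apply: variation_fin_ub => // i; apply: subset_trans AB.
Qed.

Lemma variation_ge (A : set T) : measurable A -> N A <= variation N A.
Proof.
move=> mA; rewrite (_ : N A = \sum_(i : unit) N A); last first.
  by rewrite (bigD1 tt)//= big1 ?adde0// => -[].
by apply: (@variation_fin_ub unit (fun=> A)) => [//|[] [] //|_ ?].
Qed.

Hypothesis N0 : N set0 = 0.
Hypothesis Nge0 : forall A, 0 <= N A.
Hypothesis Nsub : forall F : nat -> set T, (forall i, measurable (F i)) ->
  trivIset setT F -> N (\bigcup_i F i) <= \sum_(0 <= i <oo) N (F i).

Lemma variation_ge0 E : 0 <= variation N E.
Proof.
apply: le_trans (@variation_fin_ub void (fun=> set0) E _ _ _) => //.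
by rewrite sume_ge0.
Qed.

Lemma variation0 : variation N set0 = 0.
Proof.
apply/eqP; rewrite eq_le variation_ge0 andbT.
apply: ge_ereal_sup => _ [n [F [mF tF F0 ->]]].
by rewrite big1// => i _; have := F0 i; rewrite subset0 => ->.
Qed.

Lemma variation_setU (A B : set T) : A `&` B = set0 ->
  variation N A + variation N B <= variation N (A `|` B).
Proof.
move=> AB0; apply: ereal_sup_add_le.
- by move=> _ [n [F [_ _ _ ->]]]; exact: sume_ge0.
- exact: variation_ge0.
move=> _ [n [F [mF tF FA ->]]]; rewrite addeC; apply: ereal_sup_add_le.
- by move=> _ [m [G [_ _ _ ->]]]; exact: sume_ge0.
- exact: sume_ge0.
move=> _ [m [G [mG tG GB ->]]].
pose H (i : 'I_m + 'I_n) := match i with inl i => G i | inr i => F i end.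
apply: le_trans (@variation_fin_ub _ H _ _ _ _).
- by rewrite big_sumType.
- by case.
- move=> [i|i] [j|j] _ _ [t [/= it jt]].
  + by congr inl; apply: tG => //; exists t.
  + by have : (A `&` B) t by [split; [exact: FA jt|exact: GB it]]; rewrite AB0.
  + by have : (A `&` B) t by [split; [exact: FA it|exact: GB jt]]; rewrite AB0.
  + by congr inr; apply: tF => //; exists t.
- by case=> i t it; [right; exact: GB it|left; exact: FA it].
Qed.

(** Cutting each piece [G i] along the [F j] and using the subadditivity of [N] gives one
    inequality. The other is finite superadditivity, applied to the partial unions. *)
Lemma variation_semi_sigma_additive : semi_sigma_additive (variation N).
Proof.
move=> F mF tF mUF.
have -> : variation N (\bigcup_i F i) = \sum_(0 <= i <oo) variation N (F i).
  apply/eqP; rewrite eq_le; apply/andP; split.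
    apply: ge_ereal_sup => _ [n [G [mG tG GF ->]]].
    apply: (@le_trans _ _ (\sum_(i < n) \sum_(0 <= j <oo) N (G i `&` F j))).
      apply: lee_sum => i _; rewrite {1}(_ : G i = \bigcup_j (G i `&` F j)).
        apply: Nsub => [j|]; first exact: measurableI.
        by apply: trivIset_setIl.
      by rewrite -setI_bigcupr; apply/esym/setIidPl; exact: GF.
    rewrite -nneseries_sum//; apply: lee_nneseries => [i _ _|j _].
      exact: sume_ge0.
    apply: variation_fin_ub.
    - by move=> i; exact: measurableI.
    - exact: trivIset_setIr.
    - by move=> i t [].
  apply: lime_le.
    by apply: is_cvg_nneseries => i _ _; exact: variation_ge0.
  apply: nearW => n; apply: (@le_trans _ _ (variation N (\bigcup_(i < n) F i))).
    elim: n => [|n IH]; first by rewrite big_geq//= variation_ge0.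
    rewrite big_nat_recr//= bigcup_mkord big_ord_recr/= -bigcup_mkord.
    apply: le_trans (leeD IH (lexx _)) (variation_setU _).
    rewrite setI_bigcupl; apply: bigcup0 => i /= ilt.
    apply: contrapT => /eqP/set0P[t [Fit Fnt]].
    have := tF i n I I; move=> /(_ (ex_intro _ t (conj Fit Fnt))) E.
    by rewrite E ltnn in ilt.
  by apply: variation_mono => t [i _ Fit]; exists i.
by apply: is_cvg_nneseries => i _ _; exact: variation_ge0.
Qed.

Definition variation_measure : {measure set T -> \bar R} :=
  HB.pack (variation N) (isMeasure.Build _ _ _ (variation N) variation0
    variation_ge0 variation_semi_sigma_additive).

End variation_measure.

(** * Integrals of nonnegative functions without measurability *)

Section lower_integral.
Context (d : measure_display) (T : measurableType d) (R : realType).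
Variable nu : {measure set T -> \bar R}.
Local Open Scope ereal_scope.
Implicit Types f g : T -> \bar R.

Lemma le_integral_ge0 f g : (forall t, 0 <= f t) -> (forall t, f t <= g t) ->
  \int[nu]_t f t <= \int[nu]_t g t.
Proof.
move=> f0 fg; rewrite !ge0_integralTE// => [|t]; last exact: le_trans (fg t).
by apply: ereal_sup_le => _ [h hf <-]; exists h => // t;
  exact: le_trans (fg t).
Qed.

(** Neither function is assumed measurable, so [N] is removed from the integral of each simple
    minorant of [f] rather than from that of [f]. *)
Lemma le_integral_null (N : set T) f g : measurable N -> nu N = 0 ->
  (forall t, 0 <= f t) -> (forall t, 0 <= g t) ->
  (forall t, ~ N t -> f t <= g t) ->
  \int[nu]_t f t <= \int[nu]_t g t.
Proof.
move=> mN N0 f0 g0 fg; rewrite [leLHS]ge0_integralTE//.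
apply: ge_ereal_sup => _ [h hf <-].
rewrite -integralT_nnsfun (ge0_negligible_integral mN measurableT)//; last 2 first.
- exact/measurable_EFinP.
- by move=> t _; rewrite lee_fin.
rewrite setTD integral_mkcond; apply: le_integral_ge0 => t; rewrite patchE;
  case: ifPn => //.
- by rewrite lee_fin.
- by rewrite inE => Nt; exact: le_trans (hf t) (fg _ Nt).
Qed.

Lemma integral_le_sum3 (N : set T) (a : R) (h f g l : T -> R) :
  measurable N -> nu N = 0 -> (0 <= a)%R ->
  (forall t, 0 <= h t)%R -> (forall t, 0 <= f t)%R ->
  (forall t, 0 <= g t)%R -> (forall t, 0 <= l t)%R ->
  measurable_fun (~` N) f -> measurable_fun (~` N) g ->
  measurable_fun (~` N) l ->
  (forall t, ~ N t -> h t <= f t + a * g t + l t)%R ->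
  \int[nu]_t (h t)%:E <=
  \int[nu]_t (f t)%:E + a%:E * \int[nu]_t (g t)%:E + \int[nu]_t (l t)%:E.
Proof.
move=> mN N0 a0 h0 f0 g0 l0 mf mg ml hfgl.
have mNC : measurable (~` N) by exact: measurableC.
have le_restrict (u : T -> R) : (forall t, 0 <= u t)%R ->
    \int[nu]_(t in ~` N) (u t)%:E <= \int[nu]_t (u t)%:E.
  move=> u0; rewrite integral_mkcond; apply: le_integral_ge0 => t;
    by rewrite patchE; case: ifPn; rewrite ?lee_fin.
apply: (@le_trans _ _
    (\int[nu]_(t in ~` N) ((f t)%:E + a%:E * (g t)%:E + (l t)%:E))).
  rewrite [leRHS]integral_mkcond; apply: (le_integral_null mN N0) => [t|t|t Nt].
  - by rewrite lee_fin.
  - rewrite patchE; case: ifPn => // _.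
    by rewrite -EFinM -!EFinD lee_fin !addr_ge0// mulr_ge0.
  - by rewrite patchE mem_set// -EFinM -!EFinD lee_fin hfgl.
rewrite ge0_integralD//; last first.
- exact/measurable_EFinP.
- by move=> t _; rewrite lee_fin.
- apply: emeasurable_funD; first exact/measurable_EFinP.
  by apply: emeasurable_funM => //; exact/measurable_EFinP.
- by move=> t _; rewrite -EFinM -EFinD lee_fin addr_ge0// mulr_ge0.
rewrite ge0_integralD//; last first.
- by apply: emeasurable_funM => //; exact/measurable_EFinP.
- by move=> t _; rewrite -EFinM lee_fin mulr_ge0.
- exact/measurable_EFinP.
- by move=> t _; rewrite lee_fin.
rewrite ge0_integralZl//; last 2 first.
- exact/measurable_EFinP.
- by move=> t _; rewrite lee_fin.
apply: leeD; last exact: le_restrict.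
apply: leeD; first exact: le_restrict.
by apply: lee_wpmul2l; [rewrite lee_fin|exact: le_restrict].
Qed.

End lower_integral.

(** * Simple functions *)

Section simple_combination.
Context (d : measure_display) (T : measurableType d) (K : numFieldType)
  (V : lmodType K).
Implicit Types (s : simple T V).

Lemma simple_fun_in s i t : simple_set s i t -> s t = simple_val s i.
Proof.
move=> it; rewrite /simple_fun (bigD1 i)//= big1 ?addr0 => [|j ji].
  by rewrite indicE mem_set// scale1r.
rewrite indicE memNset ?scale0r// => jt; move/eqP: ji; apply.
by apply: (simple_disjoint (s := s)) => //; exists t.
Qed.

Lemma simple_fun_notin s t : (forall i, ~ simple_set s i t) -> s t = 0.
Proof.
move=> nt; rewrite /simple_fun big1// => i _.
by rewrite indicE memNset ?scale0r//; exact: nt.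
Qed.

Lemma simple_funP s t :
  (exists i, simple_set s i t /\ s t = simple_val s i) \/
  ((forall i, ~ simple_set s i t) /\ s t = 0).
Proof.
have [[i it]|nt] := pselect (exists i, simple_set s i t).
  by left; exists i; split=> //; exact: simple_fun_in.
have {}nt i : ~ simple_set s i t by move=> it; apply: nt; exists i.
by right; split=> //; exact: simple_fun_notin.
Qed.

Lemma simple_of_disjoint (I : finType) (E : I -> set T) (x : I -> V) :
  (forall i, measurable (E i)) -> trivIset setT E ->
  exists s : simple T V,
    [/\ forall t, s t = \sum_(i : I) (\1_(E i) t : K) *: x i,
        forall (W : lmodType K) (mu : set T -> {linear V -> W}),
          simple_int mu s = \sum_(i : I) mu (E i) (x i) &
        forall i, exists j, simple_set s i = E j /\ simple_val s i = x j].
Proof.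
move=> mE tE.
have tE' : trivIset setT (fun i : 'I_#|I| => E (enum_val i)).
  by move=> i j _ _ /(tE _ _ Logic.I Logic.I)/enum_val_inj.
exists (@Simple _ T K V #|I| (fun i => E (enum_val i)) (fun i => x (enum_val i))
  (fun i => mE _) tE'); split=> [t|W mu|i]; last by exists (enum_val i).
- rewrite /simple_fun/= [RHS](reindex_onto enum_val enum_rank)/=.
    by apply: eq_bigl => i; rewrite enum_valK eqxx.
  by move=> i _; rewrite enum_rankK.
- rewrite /simple_int/= [RHS](reindex_onto enum_val enum_rank)/=.
    by apply: eq_bigl => i; rewrite enum_valK eqxx.
  by move=> i _; rewrite enum_rankK.
Qed.

Definition finitely_additive (W : lmodType K) (mu : set T -> {linear V -> W}) :=
  (forall x, mu set0 x = 0) /\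
  forall A B x, measurable A -> measurable B -> A `&` B = set0 ->
    mu (A `|` B) x = mu A x + mu B x.

Lemma finitely_additive_bigU (W : lmodType K) (mu : set T -> {linear V -> W})
    (I : finType) (P : pred I) (E : I -> set T) x :
  finitely_additive mu ->
  (forall i, measurable (E i)) -> trivIset setT E ->
  mu (\big[setU/set0]_(i | P i) E i) x = \sum_(i | P i) mu (E i) x.
Proof.
move=> [mu0 muU] mE tE.
elim: (index_enum I) (index_enum_uniq I) => [|i r IH]; first by rewrite !big_nil mu0.
move=> /= /andP[ir ur]; rewrite !big_cons; case: ifPn => Pi; last exact: IH.
rewrite muU ?IH//; first exact: bigsetU_measurable.
rewrite -bigcup_seq_cond setI_bigcupr; apply: bigcup0 => j /= /andP[jr _].
apply: contrapT => /eqP/set0P ij; move: ir.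
by rewrite (tE i j _ _ ij)// jr.
Qed.

(* The values of [s] are taken on the atoms of the algebra generated by the
   sets [E i]. *)
Lemma simple_of_family (I : finType) (E : I -> set T) (x : I -> V) :
  (forall i, measurable (E i)) ->
  exists s : simple T V,
    (forall t, s t = \sum_(i : I) (\1_(E i) t : K) *: x i) /\
    forall (W : lmodType K) (mu : set T -> {linear V -> W}),
      finitely_additive mu -> simple_int mu s = \sum_(i : I) mu (E i) (x i).
Proof.
move=> mE.
pose A (J : {set I}) := [set t | forall i, (i \in J) = (t \in E i)].
have mA J : measurable (A J).
  rewrite (_ : A J = \bigcap_(i in [set: I]) (if i \in J then E i else ~` E i)).
    apply: fin_bigcap_measurable => [|i _]; first exact: finite_finset.
    by case: ifPn => // _; exact: measurableC.
  apply/seteqP; split=> [t At i _|t At i].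
    by case: ifPn => [|/negP]; rewrite At inE.
  by have := At i Logic.I; case: ifPn => _ h; apply/esym; [exact: mem_set|exact: memNset].
have tA : trivIset setT A.
  by move=> J J' _ _ [t [Jt J't]]; apply/setP => i; rewrite Jt J't.
have EA i : E i = \big[setU/set0]_(J : {set I} | i \in J) A J.
  rewrite -bigcup_seq_cond; apply/seteqP; split=> [t Eit|t [J /= /andP[_ iJ] At]].
    exists [set i | t \in E i]%SET; last by move=> j; rewrite finset.in_set.
    by rewrite /= mem_index_enum/= finset.in_set; exact: mem_set.
  by move: (At i); rewrite iJ => /esym/set_mem.
have [s [sfun sint _]] := simple_of_disjoint (fun J : {set I} => \sum_(i in J) x i) mA tA.
exists s; split=> [t|W mu fmu].
  pose Jt : {set I} := [set i | t \in E i]%SET.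
  rewrite sfun (bigD1 Jt)//= [X in _ + X]big1 ?addr0; last first.
    move=> J JJt; rewrite indicE memNset ?scale0r// => At.
    by move/eqP: JJt; apply; apply/setP => i; rewrite finset.in_set At.
  rewrite indicE mem_set ?scale1r; last by move=> i; rewrite finset.in_set.
  rewrite big_mkcond/=; apply: eq_bigr => i _; rewrite indicE finset.in_set.
  by case: (t \in E i); rewrite ?scale1r ?scale0r.
rewrite sint; under eq_bigr do rewrite linear_sum.
rewrite (exchange_big_dep predT)//=; apply: eq_bigr => i _.
by rewrite EA finitely_additive_bigU.
Qed.

(** The sets of [s1] meet those of [s2], so the combination is first an overlapping family and has
    to be rewritten on atoms; finite additivity of [mu] makes the integral insensitive to this. *)
Lemma simple_linear (a : K) (s1 s2 : simple T V) :
  exists s : simple T V,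
    (forall t, s t = a *: s1 t + s2 t) /\
    forall (W : lmodType K) (mu : set T -> {linear V -> W}),
      finitely_additive mu ->
      simple_int mu s = a *: simple_int mu s1 + simple_int mu s2.
Proof.
pose I : finType := ('I_(simple_size s1) + 'I_(simple_size s2))%type.
pose E (i : I) := match i with inl i => simple_set s1 i | inr i => simple_set s2 i end.
pose x (i : I) :=
  match i with inl i => a *: simple_val s1 i | inr i => simple_val s2 i end.
have [[i|i]|s [sfun sint]] := @simple_of_family I E x; [exact: simple_measurable..|].
exists s; split=> [t|W mu fmu].
  rewrite sfun big_sumType/= scaler_sumr; congr (_ + _).
  by apply: eq_bigr => i _; rewrite scalerA mulrC -scalerA.
rewrite sint// big_sumType/= scaler_sumr; congr (_ + _).
by apply: eq_bigr => i _; rewrite linearZ.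
Qed.

End simple_combination.

(** * Operator-valued measures *)

Section simple_integral.
Context (d : measure_display) (T : measurableType d) (R : realType)
  (K : numFieldType) (V : lmodType K).
Local Open Scope ereal_scope.

(** The condition [psi 0 = 0] accounts for the points that lie in no set of [s]. *)
Lemma simple_compE (psi : V -> \bar R) (s : simple T V) t : psi 0%R = 0 ->
  psi (s t) = \sum_(i < simple_size s)
    psi (simple_val s i) * (\1_(simple_set s i) t)%:E.
Proof.
move=> psi0; have [[i [it ->]]|[nt ->]] := simple_funP s t.
  rewrite (bigD1 i)//= big1 ?adde0 => [|j ji].
    by rewrite indicE mem_set// mule1.
  rewrite indicE memNset ?mule0// => jt; move/eqP: ji; apply.
  by apply: (simple_disjoint (s := s)) => //; exists t.
rewrite psi0 big1// => i _; rewrite indicE memNset ?mule0//; exact: nt.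
Qed.

Lemma simple_comp_measurable (psi : V -> \bar R) (s : simple T V) :
  psi 0%R = 0 -> measurable_fun setT (fun t => psi (s t)).
Proof.
move=> psi0; under eq_fun do rewrite simple_compE//.
apply: emeasurable_sum => i; apply: emeasurable_funM => //.
by apply/measurable_EFinP/measurable_indic; exact: simple_measurable.
Qed.

Lemma integral_simple (nu : {measure set T -> \bar R}) (psi : V -> \bar R)
    (s : simple T V) : psi 0%R = 0 -> (forall x, 0 <= psi x) ->
  \int[nu]_t psi (s t) =
  \sum_(i < simple_size s) psi (simple_val s i) * nu (simple_set s i).
Proof.
move=> psi0 psi_ge0; under eq_integral do rewrite simple_compE//.
have mi i : measurable_fun setT (fun t => (\1_(simple_set s i) t)%:E : \bar R).
  by apply/measurable_EFinP/measurable_indic; exact: simple_measurable.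
rewrite ge0_integral_sum//.
- apply: eq_bigr => i _; rewrite ge0_integralZl//.
  by rewrite integral_indic ?setIT//; exact: simple_measurable.
- by move=> i; apply: emeasurable_funM.
- by move=> i t _; rewrite mule_ge0// lee_fin.
Qed.

End simple_integral.

Section opnorm.
Context (R : realType) (k : scalar_kind)
  (X Y : normedModType (scalar_field R k)).
Local Open Scope ereal_scope.

(** Homogeneity is assumed in place of a packed linear map because the lemma is applied to raw
    functions such as a partial sum minus its limit. The operator norm may be [+oo], which makes a
    vector of norm 0 a separate case. *)
Lemma le_opnorm (A : X -> Y) x :
  (forall a x, A (a *: x) = a *: A x)%R ->
  (rnorm (A x))%:E <= (rnorm x)%:E * opnorm A.
Proof.
move=> AZ; have [x0|x0] := eqVneq (rnorm x) 0%R.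
  rewrite x0 mul0e (rnorm_eq0 x0) (_ : A 0%R = 0%R) ?rnorm0//.
  by rewrite -(scale0r 0%R) AZ scale0r.
have {}x0 : (0 < rnorm x)%R by rewrite lt_neqAle eq_sym x0 rnorm_ge0.
pose u := (scalar_of k (rnorm x)^-1 *: x)%R.
have xu : x = (scalar_of k (rnorm x) *: u)%R.
  by rewrite /u scalerA -scalar_ofM mulfV ?gt_eqF// scalar_of1 scale1r.
have u1 : (rnorm u <= 1)%R.
  by rewrite /u rnormZr gtr0_norm ?invr_gt0// mulVf ?gt_eqF.
rewrite {1}xu AZ rnormZr gtr0_norm// EFinM lee_pmul2l//.
by apply: ereal_sup_ubound; exists u.
Qed.

Lemma opnorm_ge0 (A : X -> Y) : 0 <= opnorm A.
Proof.
apply: le_trans (ereal_sup_ubound (imageP _ _)).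
  by rewrite lee_fin; exact: (@rnorm_ge0 _ _ _ (A 0%R)).
by rewrite /= rnorm0.
Qed.

End opnorm.

Section operator_measure_theory.
Context (d : measure_display) (T : measurableType d) (R : realType)
  (k : scalar_kind) (X Y : normedModType (scalar_field R k)).
Local Notation K := (scalar_field R k).
Variable mu : set T -> {linear X -> Y}.
Hypothesis mu_om : operator_measure mu.

Lemma operator_measure_cvg (F : nat -> set T) x :
  (forall i, measurable (F i)) -> trivIset setT F ->
  \sum_(0 <= i < n) mu (F i) x @[n --> \oo] --> mu (\bigcup_i F i) x.
Proof.
move=> mF tF; apply/cvg_rnormP.
have opc := mu_om.2 F mF tF.
pose u n := ((rnorm x)%:E * opnorm (fun x : X =>
  (\sum_(0 <= i < n) mu (F i) x - mu (\bigcup_i F i) x)%R))%E.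
have u0 : u n @[n --> \oo] --> ((rnorm x)%:E * 0)%E by exact: cvgeZl opc.
rewrite mule0 in u0.
have : (rnorm (\sum_(0 <= i < n) mu (F i) x - mu (\bigcup_i F i) x))%:E
    @[n --> \oo] --> 0%E.
  apply: (@squeeze_cvge _ _ _ _ (fun=> 0%E) _ u) => //; last exact: cvg_cst.
  apply: nearW => n; rewrite lee_fin rnorm_ge0/=.
  apply: (@le_opnorm _ _ _ _ (fun x : X =>
    (\sum_(0 <= i < n) mu (F i) x - mu (\bigcup_i F i) x)%R)) => a y.
  rewrite linearZ scalerBr scaler_sumr; congr (_ - _).
  by apply: eq_bigr => i _; rewrite linearZ.
by move/fine_cvgP => [].
Qed.

Lemma operator_measure_additive : finitely_additive mu.
Proof.
have mu0 x : mu set0 x = 0.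
  have t0 : trivIset setT (fun _ : nat => set0 : set T).
    by move=> i j _ _ [t []].
  have := @operator_measure_cvg (fun=> set0) x (fun=> measurable0) t0.
  rewrite bigcup0// => c0.
  (* The terms of a convergent series tend to 0, and here they are all equal to [mu set0 x]. *)
  have : cvgn (series (fun _ : nat => mu set0 x)) by apply/cvg_ex; eexists; exact: c0.
  move=> /cvg_series_cvg_0 c1; exact: (cvg_unique (@norm_hausdorff _ _) (cvg_cst _) c1).
split=> // A B x mA mB AB0.
(* The sequence continues with empty sets, so its partial sums are constant from index 2 on. *)
have c := @operator_measure_cvg (bigcup2 A B) x _ _.
rewrite bigcup2E in c; apply: (cvg_unique (@norm_hausdorff _ _) (c _ _)).
- by move=> [|[|n]] /=.
- by rewrite -trivIset_bigcup2.
apply: cvg_near_cst; near=> n.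
have n2 : (2 <= n)%N by near: n; exists 2%N.
rewrite (big_cat_nat (n := 2))//= big_nat_recr//= big_nat1/=.
rewrite big_nat_cond big1 ?addr0// => i /andP[/andP[]].
by case: i => [|[|i]].
Unshelve. all: by end_near. Qed.

Section dual_variation.
Variable y1 : {linear Y -> K^o}.
Hypothesis cy1 : continuous y1.
Local Open Scope ereal_scope.

Let N E := opnorm (fun x : X => y1 (mu E x)).

Let N0 : N set0 = 0.
Proof.
apply/eqP; rewrite eq_le opnorm_ge0 andbT; apply: ge_ereal_sup => _ [x _ <-].
by rewrite operator_measure_additive.1 linear0 rnorm0.
Qed.

(** For each fixed [x] in the unit ball, the triangle inequality for partial sums passes to the
    limit because [y1] is continuous; the supremum over [x] is taken afterwards. *)
Let Nsub (F : nat -> set T) : (forall i, measurable (F i)) ->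
  trivIset setT F -> N (\bigcup_i F i) <= \sum_(0 <= i <oo) N (F i).
Proof.
move=> mF tF; apply: ge_ereal_sup => _ [x /= x1 <-].
have cvgx : (rnorm (y1 (\sum_(0 <= i < n) mu (F i) x)))%:E @[n --> \oo] -->
    (rnorm (y1 (mu (\bigcup_i F i) x)))%:E.
  apply: cvg_EFin; first by near=> n.
  apply: cvg_rnorm; apply: continuous_cvg; first exact: cy1.
  exact: operator_measure_cvg.
rewrite -(cvg_lim _ cvgx)//; apply: lime_le; first by apply/cvg_ex; eexists; exact: cvgx.
apply: nearW => n; rewrite linear_sum/=.
apply: le_trans (nneseries_lim_ge n _); last by move=> i _ _; exact: opnorm_ge0.
apply: (@le_trans _ _ (\sum_(0 <= i < n) (rnorm (y1 (mu (F i) x)))%:E)).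
  by rewrite sumEFin lee_fin rnorm_sum.
by apply: lee_sum => i _; apply: ereal_sup_ubound; exists x.
Unshelve. all: by end_near. Qed.

(** [mu_XY] integrates against a bare set function. This packaged measure is convertible to it,
    which makes the integration theorems available. *)
Definition dual_variation_measure : {measure set T -> \bar R} :=
  variation_measure N0 (fun A => opnorm_ge0 _) Nsub.

Lemma dual_variation_measureE :
  dual_variation_measure = dual_variation mu y1 :> (set T -> \bar R).
Proof. by []. Qed.

Lemma simple_int_le (s : simple T X) :
  (rnorm (y1 (simple_int mu s)))%:E <=
  \int[dual_variation mu y1]_t (rnorm (s t))%:E.
Proof.
rewrite -dual_variation_measureE.
rewrite (@integral_simple _ _ _ _ _ _ (fun x => (rnorm x)%:E)); last 2 first.
- by rewrite rnorm0.
- by move=> x; rewrite lee_fin rnorm_ge0.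
rewrite /simple_int linear_sum/=.
apply: (@le_trans _ _
    (\sum_(i < simple_size s) (rnorm (y1 (mu (simple_set s i) (simple_val s i))))%:E)).
  by rewrite sumEFin lee_fin rnorm_sum.
apply: lee_sum => i _.
apply: le_trans (le_opnorm (A := fun x => y1 (mu (simple_set s i) x)) _ _) _.
  by move=> a x; rewrite !linearZ.
rewrite lee_wpmul2l ?lee_fin ?rnorm_ge0//.
by apply: variation_ge; exact: simple_measurable.
Qed.

End dual_variation.
End operator_measure_theory.

(** * Young functions *)

Section young_primitive.
Context (R : realType).
Variable c : \bar R -> \bar R.
Local Open Scope ereal_scope.
Hypothesis c0 : forall u, 0 <= u -> 0 <= c u.
Hypothesis c_nd : forall u v, 0 <= u -> u <= v -> c u <= c v.

Let domE (r : R) : [set t : R | 0 <= t%:E <= r%:E] = `[0%R, r]%classic.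
Proof. by apply/seteqP; split=> t /=; rewrite in_itv/= !lee_fin. Qed.

Lemma young_primitive_ge0 u : 0 <= young_primitive c u.
Proof. by apply: integral_ge0 => t /= /andP[t0 _]; exact: c0. Qed.

Lemma young_primitive_le u v : u <= v ->
  young_primitive c u <= young_primitive c v.
Proof.
move=> uv; rewrite /young_primitive integral_mkcond [leRHS]integral_mkcond.
apply: le_integral_ge0 => t; rewrite !patchE.
  by case: ifPn => //; rewrite inE/= => /andP[t0 _]; exact: c0.
case: ifPn => [|_].
  by rewrite inE/= => /andP[t0 tu]; rewrite mem_set//= t0 (le_trans tu).
by case: ifPn => //; rewrite inE/= => /andP[t0 _]; exact: c0.
Qed.

(** On [[0, r]] the integrand is at most [c r]. This yields both [theta u <= u * chi u] and the
    corresponding bound of [phi] by the inverse of [chi]. *)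
Lemma young_primitive_le_mul (r : R) : (0 <= r)%R ->
  young_primitive c r%:E <= r%:E * c r%:E.
Proof.
move=> r0; rewrite /young_primitive domE.
apply: (@le_trans _ _ (\int[lebesgue_measure]_(t in `[0%R, r]) (cst (c r%:E)) t)).
  rewrite [leLHS]integral_mkcond [leRHS]integral_mkcond.
  apply: le_integral_ge0 => t; rewrite !patchE; case: ifPn => //;
    rewrite inE/= in_itv/= => /andP[t0 tr].
  - by apply: c0; rewrite lee_fin.
  - by apply: c_nd; rewrite lee_fin.
rewrite integral_cst//= lebesgue_measure_itv/= lte_fin muleC.
case: ifPn; first by rewrite oppr0 adde0.
by rewrite -leNgt => r0'; rewrite (_ : r = 0%R)//; apply/eqP; rewrite eq_le r0 r0'.
Qed.

Lemma young_primitive0 : young_primitive c 0 = 0.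
Proof.
apply/eqP; rewrite eq_le young_primitive_ge0 andbT.
by have := young_primitive_le_mul (lexx 0%R); rewrite mul0e.
Qed.

Let measurable_c (r : R) : measurable_fun (`[0%R, r] : set R) (fun t : R => c t%:E).
Proof.
move=> mD; apply: (measurability _ (ErealGenOInfty.measurableE R)) => //.
move=> _ [_ [x ->] <-]; apply: is_interval_measurable => s t /=.
rewrite !in_itv/= !andbT => -[/andP[s0 sr] xs] [/andP[t0 tr] xt] u /andP[su ut].
split; first by rewrite /= in_itv/= (le_trans s0 su) (le_trans ut tr).
by rewrite in_itv/= andbT (lt_le_trans xs)// c_nd ?lee_fin.
Qed.

Let young_primitive_ge (q r : R) : (0 <= q)%R -> (q <= r)%R ->
  young_primitive c q%:E + (r - q)%:E * c q%:E <= young_primitive c r%:E.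
Proof.
move=> q0 qr; rewrite /young_primitive !domE.
have U : `[0%R, r]%classic = (`[0%R, q] `|` `]q, r])%classic.
  by rewrite -itv_bndbnd_setU ?bnd_simp.
rewrite U ge0_integral_setU//; last 3 first.
- by rewrite -U; exact: measurable_c.
- by rewrite -U => t /=; rewrite in_itv/= => /andP[t0 _]; apply: c0; rewrite lee_fin.
- apply/disj_setPS => t [] /=; rewrite !in_itv/= => /andP[_ tq] /andP[qt _].
  by move: (lt_le_trans qt tq); rewrite ltxx.
apply: leeD => //.
apply: (@le_trans _ _ (\int[lebesgue_measure]_(t in `]q, r]) (cst (c q%:E)) t)).
  rewrite integral_cst//= lebesgue_measure_itv/= lte_fin muleC.
  case: ifPn => // qr'.
  by rewrite (_ : r = q) ?subrr//; apply/eqP; rewrite eq_le qr andbT leNgt.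
rewrite [leLHS]integral_mkcond [leRHS]integral_mkcond.
apply: le_integral_ge0 => t; rewrite !patchE; case: ifPn => //;
  rewrite inE/= in_itv/= => /andP[qt tr].
- by apply: c0; rewrite lee_fin.
- by apply: c_nd; rewrite lee_fin// ltW.
Qed.

(** Convexity between 0 and [r]. Write P for the primitive and [q = a * r]. By monotonicity P(r) is
    at least P(q) + (r - q) c(q); after multiplication by [a], the identity a (r - q) = (1 - a) q
    and the bound q c(q) >= P(q) conclude. *)
Lemma young_primitive_convex0 (a r : R) : (0 <= a <= 1)%R -> (0 <= r)%R ->
  young_primitive c (a * r)%:E <= a%:E * young_primitive c r%:E.
Proof.
move=> /andP[a0 a1] r0.
have ar0 : (0 <= a * r)%R by rewrite mulr_ge0.
have arr : (a * r <= r)%R by rewrite ler_piMl.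
have q0 : 0 <= c (a * r)%:E by rewrite c0 ?lee_fin.
apply: le_trans (lee_wpmul2l _ (young_primitive_ge ar0 arr)); last by rewrite lee_fin.
rewrite ge0_muleDr ?young_primitive_ge0//; last by rewrite mule_ge0 ?lee_fin ?subr_ge0.
set p := young_primitive c (a * r)%:E.
have p0 : 0 <= p by exact: young_primitive_ge0.
rewrite muleA -EFinM (_ : a * (r - a * r) = (1 - a) * (a * r))%R; last by ring.
rewrite EFinM -muleA.
apply: (@le_trans _ _ (a%:E * p + (1 - a)%:E * p)).
  by rewrite -ge0_muleDl ?lee_fin ?subr_ge0// -EFinD addrC subrK mul1e.
by rewrite leeD2l// lee_wpmul2l ?lee_fin ?subr_ge0// young_primitive_le_mul.
Qed.

End young_primitive.

Section young_conjugate.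
Context (R : realType).
Variable chi : \bar R -> \bar R.
Hypothesis ychi : young_density chi.
Local Open Scope ereal_scope.

Lemma young_density_ge0 u : 0 <= u -> 0 <= chi u.
Proof. by case: ychi => _ + _ _; exact. Qed.

Lemma young_density_nd u v : 0 <= u -> u <= v -> chi u <= chi v.
Proof. by case: ychi => _ _ + _; exact. Qed.

Lemma young_inverse_ge0 v : 0 <= v -> 0 <= young_inverse chi v.
Proof.
move=> v0; rewrite /young_inverse; case: ifPn => // vn0.
apply: ereal_sup_ubound; split=> //; case: ychi => -> _ _ _.
by rewrite lt_neqAle eq_sym vn0.
Qed.

Lemma young_inverse_nd u v : 0 <= u -> u <= v ->
  young_inverse chi u <= young_inverse chi v.
Proof.
move=> u0 uv; have [->|un0] := eqVneq u 0.
  by rewrite {1}/young_inverse eqxx young_inverse_ge0// (le_trans u0).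
rewrite /young_inverse (negbTE un0) ifN.
  by apply: ereal_sup_le => w [w0 wu]; split => //; exact: lt_le_trans uv.
by rewrite gt_eqF// (lt_le_trans _ uv)// lt_neqAle eq_sym un0.
Qed.

(** Half of a Galois relation: [chi w < v] and [v <= chi u] exclude [u < w], as [chi] is
    nondecreasing. *)
Lemma young_inverse_le u v : 0 <= u -> v <= chi u -> young_inverse chi v <= u.
Proof.
move=> u0 vu; rewrite /young_inverse; case: ifPn => // _.
apply: ge_ereal_sup => w [w0 wv]; rewrite leNgt; apply/negP => uw.
have := lt_le_trans wv vu; rewrite ltNge => /negP; apply.
by apply: young_density_nd => //; exact: ltW.
Qed.

Lemma young_conjugate_le (u v : R) : (0 <= u)%R -> (0 <= v)%R ->
  v%:E <= chi u%:E -> young_primitive (young_inverse chi) v%:E <= (u * v)%:E.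
Proof.
move=> u0 v0 vu.
apply: le_trans (young_primitive_le_mul young_inverse_ge0 young_inverse_nd v0) _.
by rewrite muleC EFinM lee_wpmul2r ?lee_fin// young_inverse_le.
Qed.

End young_conjugate.

(** * The Orlicz norm controls the modular *)

Section simple_map.
Context (d : measure_display) (T : measurableType d) (K : numFieldType)
  (V W : lmodType K).

Let simple_map_measurable (s : simple T V) (B : set T) (mB : measurable B) i :
  measurable (simple_set s i `&` B).
Proof. by apply: measurableI => //; exact: simple_measurable. Qed.

Let simple_map_disjoint (s : simple T V) (B : set T) :
  trivIset setT (fun i => simple_set s i `&` B).
Proof. exact: trivIset_setIr (simple_disjoint (s := s)). Qed.

Definition simple_map (s : simple T V) (B : set T) (mB : measurable B)
    (w : 'I_(simple_size s) -> W) : simple T W :=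
  @Simple _ T K W (simple_size s) (fun i => simple_set s i `&` B) w
    (simple_map_measurable mB) (@simple_map_disjoint s B).

End simple_map.

(** Off [B] the new function is 0 although [s] may not be, whence the condition on [f (s t) 0]. *)
Lemma simple_map_comp (d : measure_display) (T : measurableType d)
    (K : numFieldType) (V W Z : lmodType K) (s : simple T V) (B : set T)
    (mB : measurable B) (w : 'I_(simple_size s) -> W) (f : V -> W -> Z) t :
  f (s t) 0 = 0 ->
  f (s t) (simple_map mB w t) =
  simple_map mB (fun i => f (simple_val s i) (w i)) t.
Proof.
move=> f0; set z := simple_map mB (fun i => f _ _).
have [[i [it wt]]|[nt wt]] := simple_funP (simple_map mB w) t.
  rewrite wt (@simple_fun_in _ _ _ _ s i); last by case: it.
  by apply/esym; exact: (@simple_fun_in _ _ _ _ z i).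
by rewrite wt f0; apply/esym; exact: (@simple_fun_notin _ _ _ _ z).
Qed.

Section sup_over.
Context (d : measure_display) (T : measurableType d) (R : realType).
Variable M : set {finite_measure set T -> \bar R}.
Local Open Scope ereal_scope.

Lemma sup_over_ge0 F : 0 <= sup_over M F.
Proof. by apply: ereal_sup_ubound; left. Qed.

Lemma sup_over_ub F m : M m -> F m <= sup_over M F.
Proof. by move=> Mm; apply: ereal_sup_ubound; right; exists m. Qed.

Lemma family_measure_ub E m : M m -> m E <= family_measure M E.
Proof. by move=> Mm; exact: (@sup_over_ub (fun m => m E)). Qed.

Lemma sup_over_le F B : 0 <= B -> (forall m, M m -> F m <= B) ->
  sup_over M F <= B.
Proof. by move=> B0 FB; apply: ge_ereal_sup => _ [->//|[m Mm <-]]; exact: FB. Qed.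

Lemma family_measure_bigU_fin (I : Type) (r : seq I) (F : I -> set T) :
  (forall i, measurable (F i)) -> (forall i, family_measure M (F i) < +oo) ->
  family_measure M (\big[setU/set0]_(i <- r) F i) < +oo.
Proof.
move=> mF Ff; elim: r => [|i r IH].
  rewrite big_nil; apply: le_lt_trans (ltry 0); apply: sup_over_le => // m _.
  by rewrite measure0.
rewrite big_cons; apply: le_lt_trans (lte_add_pinfty (Ff i) IH).
apply: sup_over_le => [|m Mm]; first by rewrite adde_ge0 ?sup_over_ge0.
apply: le_trans (measureU2 _ _ _) _ => //; first exact: bigsetU_measurable.
by apply: leeD; exact: family_measure_ub.
Qed.

End sup_over.

Section orlicz_modular.
Context (d : measure_display) (T : measurableType d) (R : realType)
  (k : scalar_kind) (X : normedModType (scalar_field R k)).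
Local Notation K := (scalar_field R k).
Variables (M : set {finite_measure set T -> \bar R}) (theta phi chi : \bar R -> \bar R).
Hypothesis ychi : young_density chi.
Local Open Scope ereal_scope.
Hypothesis thetaE : forall u, 0 <= u -> theta u = young_primitive chi u.
Hypothesis phiE : forall v, 0 <= v -> phi v = young_primitive (young_inverse chi) v.

Let chi_ge0 := young_density_ge0 ychi.
Let chi_nd := young_density_nd ychi.
Let xi_ge0 := young_inverse_ge0 ychi.
Let xi_nd := young_inverse_nd ychi.

Lemma theta_ge0 (r : R) : (0 <= r)%R -> 0 <= theta r%:E.
Proof. by move=> r0; rewrite thetaE ?lee_fin// young_primitive_ge0. Qed.

Lemma theta0 : theta 0 = 0.
Proof. by rewrite thetaE// young_primitive0. Qed.

Let phi_ge0 (r : R) : (0 <= r)%R -> 0 <= phi r%:E.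
Proof. by move=> r0; rewrite phiE ?lee_fin// young_primitive_ge0. Qed.

Let phi0 : phi 0 = 0.
Proof. by rewrite phiE// young_primitive0. Qed.

Section bounded_set.
Variables (s : simple T X) (l : R) (B : set T).
Hypothesis l0 : (0 < l)%R.
Hypothesis sl : orlicz_norm M phi s <= l%:E.
Hypothesis mB : measurable B.
Hypothesis MB : family_measure M B < +oo.

Let u i := (rnorm (simple_val s i) / (2 * l))%R.

Let u0 i : (0 <= u i)%R.
Proof. by rewrite divr_ge0 ?rnorm_ge0// mulr_ge0// ltW. Qed.

Let E i := simple_set s i `&` B.

(* If the modular [P] of [c] were larger than 1, then [c / P] would be
   admissible, and the pointwise inequality [phi c <= u c] would give
   [P <= P / 2]. *)
Let admissible_le (c : 'I_(simple_size s) -> R) :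
  (forall i, (0 <= c i)%R) -> (forall i, (c i)%:E <= chi (u i)%:E) ->
  forall m, M m ->
  \sum_(i < simple_size s) (u i * c i)%:E * m (E i) <= 1.
Proof.
move=> c0 cu; have uc0 i : (0 <= u i * c i)%R by exact: mulr_ge0.
pose g (a : R) : simple T K^o :=
  simple_map (W := K^o) mB (fun i : 'I_(simple_size s) => scalar_of k (a * c i)).
pose Q m := \sum_(i < simple_size s) (u i * c i)%:E * m (E i).
have Q0 (m : {finite_measure set T -> \bar R}) : 0 <= Q m.
  by apply: sume_ge0 => i _; rewrite mule_ge0// lee_fin mulr_ge0.
have modE a (m : {finite_measure set T -> \bar R}) : (0 <= a)%R ->
    \int[m]_t phi (rnorm (g a t))%:E =
    \sum_(i < simple_size s) phi (a * c i)%:E * m (E i).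
  move=> a0; rewrite (@integral_simple _ _ _ _ K^o m (fun x : K^o => phi (rnorm x)%:E)).
  - apply: eq_bigr => i _ /=.
    by rewrite rnorm_scalar_of ger0_norm// mulr_ge0.
  - by rewrite rnorm0 phi0.
  - by move=> x; rewrite phi_ge0// rnorm_ge0.
(* The integral of the norm of [g a] times [s] equals [2 * l * a * Q m], because [u] is the norm of
   [s] divided by [2 * l]; the Orlicz bound [l] thus becomes 1/2. *)
have admQ a : (0 <= a)%R -> modular M phi (g a) <= 1 ->
    forall m, M m -> a%:E * Q m <= 2^-1%:E.
  move=> a0 ga m Mm.
  have : \int[m]_t (rnorm (g a t *: s t)%R)%:E <= l%:E.
    apply: le_trans sl; apply: le_trans (sup_over_ub _ Mm).
    by apply: ereal_sup_ubound; exists (g a).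
  under eq_integral => t _.
    rewrite (simple_map_comp mB _ (f := fun x z => (z : K) *: x)) ?scale0r//.
    over.
  rewrite (@integral_simple _ _ _ _ X m (fun x => (rnorm x)%:E)); last 2 first.
  - by rewrite rnorm0.
  - by move=> x; rewrite lee_fin rnorm_ge0.
  rewrite (_ : \sum_(i < _) _ = (2 * l)%:E * (a%:E * Q m)).
    rewrite -lee_pdivlMl ?mulr_gt0// -EFinM invfM -mulrA mulVf ?mulr1//.
    by rewrite gt_eqF.
  rewrite muleA -EFinM ge0_sume_distrr; last first.
    by move=> i _; rewrite mule_ge0// lee_fin mulr_ge0.
  apply: eq_bigr => i _ /=; rewrite rnormZr !muleA -!EFinM; congr (_%:E * _).
  rewrite ger0_norm ?mulr_ge0// /u; field.
  by rewrite gt_eqF.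
have phiQ (m : {finite_measure set T -> \bar R}) :
    \sum_(i < simple_size s) phi (c i)%:E * m (E i) <= Q m.
  apply: lee_sum => i _; rewrite lee_wpmul2r//.
  by rewrite phiE ?lee_fin// young_conjugate_le.
have Qfin m : M m -> Q m <= \sum_(i < simple_size s) (u i * c i)%:E * family_measure M B.
  move=> Mm; apply: lee_sum => i _; rewrite lee_wpmul2l ?lee_fin//.
  apply: le_trans (family_measure_ub B Mm).
  apply: le_measure; rewrite ?inE//; last by move=> t [].
  by apply: measurableI => //; exact: simple_measurable.
have Mfin : family_measure M B \is a fin_num.
  by rewrite ge0_fin_numE// sup_over_ge0.
have mod1E (m : {finite_measure set T -> \bar R}) :
    \int[m]_t phi (rnorm (g 1%R t))%:E =
    \sum_(i < simple_size s) phi (c i)%:E * m (E i).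
  by rewrite modE//; under eq_bigr do rewrite mul1r.
(* [Qfin] bounds all the [Q m] by one finite multiple of the [M]-measure of [B]; hence the supremum
   over [M] is finite and can be divided by. *)
have Pfin : modular M phi (g 1%R) \is a fin_num.
  rewrite ge0_fin_numE ?sup_over_ge0//.
  apply: (@le_lt_trans _ _ (\sum_(i < simple_size s) (u i * c i)%:E * family_measure M B)).
    apply: sup_over_le => [|m Mm].
      by apply: sume_ge0 => i _; rewrite mule_ge0 ?sup_over_ge0// lee_fin mulr_ge0.
    by rewrite mod1E; apply: le_trans (phiQ m) (Qfin _ Mm).
  rewrite ltey_eq; apply/orP; left; apply/sum_fin_numP => i _ _.
  by rewrite fin_numM.
pose p := fine (modular M phi (g 1%R)).
have pE : p%:E = modular M phi (g 1%R) by rewrite fineK.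
move=> m Mm; apply: (@le_trans _ _ 2^-1%:E); last by rewrite lee_fin invf_le1 ?ler1n.
have [p1|p1] := leP p 1%R.
  by rewrite -[leLHS]mul1e; apply: admQ => //; rewrite -pE lee_fin.
have p0 : (0 < p)%R by rewrite (lt_trans _ p1).
have pV0 : (0 <= p^-1)%R by rewrite invr_ge0 ltW.
have a01 : (0 <= p^-1 <= 1)%R by rewrite invr_ge0 ltW//= invf_le1// ltW.
(* Convexity through 0 gives [phi (c / p) <= phi c / p], so the modular drops to at most 1 for all
   measures of [M] simultaneously. *)
have ga : modular M phi (g p^-1%R) <= 1.
  apply: sup_over_le => // m' Mm'; rewrite modE//.
  apply: (@le_trans _ _ (p^-1%:E * \sum_(i < simple_size s) phi (c i)%:E * m' (E i))).
    rewrite ge0_sume_distrr => [|i _]; last by rewrite mule_ge0// phi_ge0.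
    apply: lee_sum => i _; rewrite muleA lee_wpmul2r//.
    rewrite !phiE ?lee_fin ?mulr_ge0//.
    by apply: young_primitive_convex0.
  rewrite lee_pdivrMl// mule1 pE -mod1E.
  exact: (@sup_over_ub _ _ _ M (fun m => \int[m]_t phi (rnorm (g 1%R t))%:E)).
have : p%:E <= (p / 2)%:E.
  rewrite pE; apply: sup_over_le => [|m' Mm'].
    by rewrite lee_fin divr_ge0// ltW.
  rewrite mod1E; apply: le_trans (phiQ m') _.
  by have := admQ _ pV0 ga _ Mm'; rewrite lee_pdivrMl.
by rewrite lee_fin ler_pdivlMr// -[leRHS]mulr1 ler_pM2l// (ler_nat _ 2 1).
Qed.

(** [theta (u i)] is at most [u i * chi (u i)], and [chi (u i)] is the supremum of the finite [c]
    below it, also when it is [+oo]. [admissible_le] applies to each choice of such values. *)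
Lemma modular_le_bounded_set m : M m ->
  \sum_(i < simple_size s) theta (u i)%:E * m (E i) <= 1.
Proof.
move=> Mm.
have mfin i : m (E i) \is a fin_num.
  apply: fin_num_measure; apply: measurableI => //; exact: simple_measurable.
pose w i := (u i * fine (m (E i)))%R.
have w0 i : (0 <= w i)%R by rewrite mulr_ge0// fine_ge0.
pose S i := [set (c%:E : \bar R) | c in [set c : R | (0 <= c)%R /\ c%:E <= chi (u i)%:E]].
have chiS i : chi (u i)%:E <= ereal_sup (S i).
  have := @chi_ge0 (u i)%:E; rewrite lee_fin u0 => /(_ erefl).
  case chiu : (chi (u i)%:E) => [r| |//] r0.
    by apply: ereal_sup_ubound; exists r => //=; rewrite chiu.
  rewrite leye_eq; apply/eqP/eqyP => A A0; apply: ereal_sup_ubound.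
  by exists A => //=; rewrite chiu leey ltW.
apply: (@le_trans _ _ (\sum_(i < simple_size s) (w i)%:E * ereal_sup (S i))).
  apply: lee_sum => i _; rewrite /w (EFinM (u i)) fineK// muleAC lee_wpmul2r//.
  rewrite thetaE ?lee_fin//.
  apply: le_trans (young_primitive_le_mul chi_ge0 chi_nd (u0 i)) _.
  by rewrite lee_wpmul2l ?lee_fin.
apply: sum_ereal_sup_le => //.
- exact: index_enum_uniq.
- by move=> i; exists 0; exists 0%R => //=; rewrite chi_ge0 ?lee_fin.
- by move=> i _ [c [c0 _] <-]; rewrite lee_fin.
move=> v Sv.
have cS i : exists c : R, [/\ (0 <= c)%R, c%:E <= chi (u i)%:E & v i = c%:E].
  by have [c [? ?] <-] := Sv i; exists c.
have /choice[c cP] := cS.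
apply: le_trans (admissible_le (c := c) _ _ Mm); last 2 first.
- by move=> i; case: (cP i).
- by move=> i; case: (cP i).
apply: lee_sum => i _; have [_ _ ->] := cP i.
by rewrite /w !(EFinM (u i)) fineK// muleAC.
Qed.

End bounded_set.

Hypothesis sbM : sigma_bounded M.

(** Sigma-boundedness exhausts [T] by finite unions [D] of finite [M]-measure; the bound 1 on each
    of them does not depend on [D] and survives the limit. *)
Lemma modular_le1 (s : simple T X) (l : R) : (0 < l)%R ->
  orlicz_norm M phi s <= l%:E ->
  modular M theta (fun t => scalar_of k (2 * l)^-1 *: s t)%R <= 1.
Proof.
move=> l0 sl; apply: sup_over_le => // m Mm.
have [F [mF tF TF Ff]] := sbM measurableT.
pose G t := theta (rnorm (scalar_of k (2 * l)^-1 *: s t)%R)%:E.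
have th0 : theta (rnorm (scalar_of k (2 * l)^-1 *: (0 : X)))%:E = 0.
  by rewrite scaler0 rnorm0 theta0.
have G0 t : 0 <= G t by rewrite theta_ge0// rnorm_ge0.
have mG : measurable_fun setT G.
  exact: (@simple_comp_measurable _ _ _ _ _
    (fun x => theta (rnorm (scalar_of k (2 * l)^-1 *: x)%R)%:E)).
have := @ge0_integral_bigcup _ _ _ m F G mF; rewrite /= -TF => ->//.
apply: lime_le; first by apply: is_cvg_nneseries => i _ _; exact: integral_ge0.
apply: nearW => n.
rewrite -ge0_integral_bigsetU//; last 3 first.
- exact: iota_uniq.
- exact: sub_trivIset tF.
- exact: measurable_funS mG.
set D := \big[setU/set0]_(_ <- _) _.
have mD : measurable D by exact: bigsetU_measurable.
rewrite integral_mkcond.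
pose sD := simple_map mD (fun i => simple_val s i).
(* Where [sD] vanishes, off [D] or off the sets of [s], this rests on [theta 0 = 0]. *)
have sDE t : (G \_ D) t = theta (rnorm (scalar_of k (2 * l)^-1 *: sD t)%R)%:E.
  rewrite patchE; have [[i [[it Dt] ->]]|[nt ->]] := simple_funP sD t.
    by rewrite mem_set// /G (simple_fun_in it).
  rewrite th0; case: ifPn => //; rewrite inE => Dt; rewrite /G simple_fun_notin//.
  by move=> i it; apply: (nt i); split.
under eq_integral do rewrite sDE.
rewrite (@integral_simple _ _ _ _ _ m
  (fun x => theta (rnorm (scalar_of k (2 * l)^-1 *: x)%R)%:E))//; last first.
  by move=> x; rewrite theta_ge0// rnorm_ge0.
have MD : family_measure M D < +oo by exact: family_measure_bigU_fin.
apply: le_trans (modular_le_bounded_set l0 sl mD MD Mm); apply: lee_sum => i _ /=.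
by rewrite rnormZr ger0_norm ?invr_ge0 ?mulr_ge0 ?(ltW l0)// (mulrC ((2 * l)^-1)%R).
Qed.

End orlicz_modular.

(** * The Orlicz norm controls the dual variations *)

Section variation_integral.
Context (d : measure_display) (T : measurableType d) (R : realType).
Variable N : set T -> \bar R.
Local Open Scope ereal_scope.
Hypothesis N0 : forall A, 0 <= N A.

(** The integral of [h] is a sum of its values times suprema over partitions of its level sets.
    Partitions chosen independently on the level sets merge into one disjoint family on which [h]
    dominates the weights. *)
Lemma sintegral_variation_le (nu : {measure set T -> \bar R})
    (h : {nnsfun T >-> R}) (B : \bar R) :
  nu = variation N :> (set T -> \bar R) ->
  (forall (J : finType) (F : J -> set T) (w : J -> R),
    (forall j, measurable (F j)) -> trivIset setT F -> (forall j, (0 <= w j)%R) ->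
    (forall j t, F j t -> (w j <= h t)%R) ->
    \sum_(j : J) (w j)%:E * N (F j) <= B) ->
  sintegral nu h <= B.
Proof.
move=> nuE hB.
rewrite sintegralE fsbig_finite//= big_seq_fsetE/=.
pose w (i : fset_set (range h)) : R := `|fsval i|%R.
pose S (i : fset_set (range h)) : set \bar R := [set v | exists n (F : 'I_n -> set T),
    [/\ forall i, measurable (F i), trivIset setT F,
        forall j, F j `<=` h @^-1` [set fsval i] & v = \sum_(i < n) N (F i)]].
apply: (@le_trans _ _ (\sum_(i : fset_set (range h)) (w i)%:E * ereal_sup (S i))).
  apply: lee_sum => i _; rewrite nuE /w ger0_norm//.
  by have := fsvalP i; rewrite in_fset_set// => /set_mem[t _ <-].
apply: sum_ereal_sup_le => //.
- exact: index_enum_uniq.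
- by move=> i; exact: normr_ge0.
- by move=> i; exists (\sum_(j < 0) N set0); exists 0%N, (fun=> set0); split=> // -[].
- by move=> i _ [n [F [_ _ _ ->]]]; exact: sume_ge0.
move=> v Sv.
have /choice[nF nFP] : forall i : fset_set (range h),
    exists p : {n : nat & 'I_n -> set T},
    [/\ forall j, measurable (projT2 p j), trivIset setT (projT2 p),
        forall j, projT2 p j `<=` h @^-1` [set fsval i] &
        v i = \sum_(j < projT1 p) N (projT2 p j)].
  by move=> i; have [n [F [? ? ? ?]]] := Sv i; exists (existT _ n F).
(* Pairs of a value of [h] and a piece of the partition chosen for its level set. *)
pose J : finType := {i : fset_set (range h) & 'I_(projT1 (nF i))}.
pose F (p : J) := projT2 (nF (tag p)) (tagged p).
apply: le_trans (hB J F (fun p => w (tag p)) _ _ _ _).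
- rewrite [leRHS](_ : _ = \sum_(i : fset_set (range h))
      \sum_(j < projT1 (nF i)) (w i)%:E * N (projT2 (nF i) j)).
    apply: lee_sum => i _; have [_ _ _ ->] := nFP i.
    by rewrite ge0_sume_distrr.
  by rewrite sig_big_dep.
- by move=> p; have [+ _ _ _] := nFP (tag p); exact.
- move=> [i a] [j b] _ _ [t []]; rewrite /F /= => it jt.
  have ij : i = j.
    have [_ _ iF _] := nFP i; have [_ _ jF _] := nFP j.
    by apply/val_inj; rewrite /= -(iF _ _ it) -(jF _ _ jt).
  move: b jt; rewrite -ij => b jt; congr existT.
  by have [_ tF _ _] := nFP i; apply: tF => //; exists t.
- by move=> p; exact: normr_ge0.
- move=> p t; have [_ _ pF _] := nFP (tag p) => /pF /= ht.
  by rewrite /w -ht ger0_norm.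
Qed.

End variation_integral.

Lemma orlicz_norm_le (d : measure_display) (T : measurableType d) (R : realType)
    (k : scalar_kind) (X : normedModType (scalar_field R k))
    (M : set {finite_measure set T -> \bar R}) phi (f g : T -> X) :
  (forall t, rnorm (f t) <= rnorm (g t)) ->
  (orlicz_norm M phi f <= orlicz_norm M phi g)%E.
Proof.
move=> fg; apply: sup_over_le => [|m Mm]; first exact: sup_over_ge0.
apply: le_trans (sup_over_ub _ Mm); apply: ge_ereal_sup => _ [s sphi <-].
apply: le_trans; last by apply: ereal_sup_ubound; exists s.
apply: le_integral_ge0 => t; rewrite lee_fin ?rnorm_ge0//.
by rewrite !rnormZ ler_wpM2l// rnorm_ge0.
Qed.

Section dual_bound.
Context (d : measure_display) (T : measurableType d) (R : realType)
  (k : scalar_kind) (X Y : normedModType (scalar_field R k)).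
Local Notation K := (scalar_field R k).
Variables (M : set {finite_measure set T -> \bar R}) (theta phi : \bar R -> \bar R).
Variable mu : set T -> {linear X -> Y}.
Hypothesis sbM : sigma_bounded M.
Hypothesis cyoung : conjugate_young theta phi.
Hypothesis mu_om : operator_measure mu.
Variable C : R.
Hypothesis C0 : 0 <= C.
Hypothesis mu_sv : (semivariation M theta mu [set: T] <= C%:E)%E.
Local Open Scope ereal_scope.

(** Finite semivariation makes [mu] vanish on [M]-null sets: there every multiple of [x] has modular
    0, so all multiples of [mu F x] stay bounded by [C]. *)
Lemma dual_variation_null (y1 : {linear Y -> K^o}) (N : set T) :
  measurable N -> family_measure M N = 0 -> dual_variation mu y1 N = 0.
Proof.
have [chi [ychi thetaE _]] := cyoung.
move=> mN MN0.
have muF0 F x : measurable F -> F `<=` N -> mu F x = 0%R.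
  move=> mF FN; apply/rnorm_eq0/eqP; rewrite eq_le rnorm_ge0 andbT leNgt.
  apply/negP => r0; set r := rnorm _ in r0.
  have t1 : trivIset setT (fun _ : 'I_1 => F).
    by move=> i j _ _ _; rewrite !ord1.
  pose s c : simple T X :=
    @Simple _ T K X 1 (fun=> F) (fun=> scalar_of k c *: x)%R (fun=> mF) t1.
  have sC c : (rnorm (mu F (scalar_of k c *: x)) <= C)%R.
    rewrite -lee_fin; apply: le_trans mu_sv; apply: ereal_sup_ubound.
    exists (s c); last by rewrite /simple_int big_ord1.
    split=> //; apply: sup_over_le => // m Mm.
    rewrite (@integral_simple _ _ _ _ _ m (fun x => theta (rnorm x)%:E)).
    - rewrite big_ord1/= [X in _ * X](_ : _ = 0) ?mule0//.
      apply/eqP; rewrite eq_le measure_ge0 andbT -MN0.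
      apply: le_trans (family_measure_ub N Mm).
      by apply: le_measure; rewrite ?inE.
    - by rewrite rnorm0 (theta0 ychi thetaE).
    - by move=> y; rewrite (theta_ge0 ychi thetaE)// rnorm_ge0.
  (* This multiple of [mu F x] has norm [C + 1]. *)
  have := sC ((C + 1) / r)%R; rewrite linearZ rnormZr -/r.
  rewrite ger0_norm ?divr_ge0 ?addr_ge0 ?(ltW r0)//.
  by rewrite divfK ?gt_eqF// leNgt ltrDl ltr01.
apply/eqP; rewrite eq_le variation_ge0 ?andbT; last by move=> ?; exact: opnorm_ge0.
apply: ge_ereal_sup => _ [n [F [mF _ FN ->]]].
rewrite big1// => i _; apply/eqP; rewrite eq_le opnorm_ge0 andbT.
apply: ge_ereal_sup => _ [x _ <-].
by rewrite muF0// linear0 rnorm0.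
Qed.

Lemma simple_int_orlicz_le (s : simple T X) (l : R) : (0 < l)%R ->
  orlicz_norm M phi s <= l%:E -> (rnorm (simple_int mu s) <= 2 * l * C)%R.
Proof.
have [chi [ychi thetaE phiE]] := cyoung.
move=> l0 sl; have := modular_le1 ychi thetaE phiE sbM l0 sl.
set a := scalar_of k _.
have [s' [s'fun s'int _]] := simple_of_disjoint (fun i => a *: simple_val s i)%R
  (simple_measurable (s := s)) (simple_disjoint (s := s)).
have s'E t : s' t = (a *: s t)%R.
  rewrite s'fun /simple_fun scaler_sumr; apply: eq_bigr => i _.
  by rewrite !scalerA mulrC.
rewrite (_ : (fun t => _) = s'); last by apply/funext => t; rewrite s'E.
move=> s'1.
have : (rnorm (simple_int mu s') <= C)%R.
  by rewrite -lee_fin; apply: le_trans mu_sv; apply: ereal_sup_ubound; exists s'.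
rewrite s'int (_ : (\sum_(i < _) _)%R = (a *: simple_int mu s)%R).
  rewrite rnormZr ger0_norm ?invr_ge0 ?mulr_ge0 ?(ltW l0)//.
  by rewrite ler_pdivrMl ?mulr_gt0.
by rewrite /simple_int scaler_sumr; apply: eq_bigr => i _; rewrite linearZ.
Qed.

(** Three suprema are unfolded in turn: simple minorants [h] of the norm of [f], partitions of the
    level sets of [h], and vectors of the unit ball in each operator norm. *)
Lemma dual_integral_le (y1 : {linear Y -> K^o}) (f : T -> X) (l : R) :
  continuous y1 -> opnorm y1 <= 1 -> (0 < l)%R -> orlicz_norm M phi f <= l%:E ->
  \int[dual_variation mu y1]_t (rnorm (f t))%:E <= (2 * l * C)%:E.
Proof.
move=> cy1 y11 l0 fl.
rewrite -(dual_variation_measureE mu_om cy1) ge0_integralTE; last first.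
  by move=> t; rewrite lee_fin rnorm_ge0.
apply: ge_ereal_sup => _ [h hf <-].
apply: (@sintegral_variation_le _ _ _ (fun E => opnorm (fun x : X => y1 (mu E x)))) => //.
  by move=> A; exact: opnorm_ge0.
move=> J F w mF tF w0 wh; apply: sum_ereal_sup_le => //.
- exact: index_enum_uniq.
- by move=> j; exists (rnorm (y1 (mu (F j) 0%R)))%:E; exists 0%R => //=; rewrite rnorm0.
- by move=> j _ [x _ <-]; rewrite lee_fin rnorm_ge0.
move=> v vP.
have /choice[x xP] : forall j, exists x : X,
    (rnorm x <= 1)%R /\ v j = (rnorm (y1 (mu (F j) x)))%:E.
  by move=> j; have [x x1 <-] := vP j; exists x.
have /choice[c cP] : forall j, exists c : K, rnorm (c : K^o) = 1%R /\
    (c * y1 (mu (F j) (x j)))%R = scalar_of k (rnorm (y1 (mu (F j) (x j)))).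
  by move=> j; exact: phase.
(* The value on [F j] has norm at most [w j], hence at most [h], and the phase [c j] makes its
   contribution to [y1 (simple_int mu s)] a nonnegative real. *)
have [s [sfun sint sval]] :=
  simple_of_disjoint (fun j => scalar_of k (w j) *: (c j *: x j))%R mF tF.
have sl : orlicz_norm M phi s <= l%:E.
  apply: le_trans fl; apply: orlicz_norm_le => t.
  have [[i [it ->]]|[_ ->]] := simple_funP s t; last by rewrite rnorm0 rnorm_ge0.
  have [j [Ej ->]] := sval i.
  have htf : (h t <= rnorm (f t))%R by rewrite -lee_fin hf.
  apply: le_trans htf; rewrite rnormZr rnormZ (cP j).1 mul1r ger0_norm//.
  apply: (@le_trans _ _ (w j)); last by apply: wh; rewrite -Ej.
  by rewrite ler_piMr// (xP j).1.
pose q j := (w j * rnorm (y1 (mu (F j) (x j))))%R.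
have q0 j : (0 <= q j)%R by rewrite mulr_ge0// rnorm_ge0.
have y1s : y1 (simple_int mu s) = scalar_of k (\sum_j q j)%R.
  rewrite sint linear_sum (big_morph _ (@scalar_ofD R k) (scalar_of0 R k)).
  apply: eq_bigr => j _; rewrite !linearZ /q scalar_ofM -(cP j).2.
  by [].
rewrite (eq_bigr (fun j => (q j)%:E)); last first.
  by move=> j _; rewrite (xP j).2 EFinM.
rewrite sumEFin -[X in X%:E]ger0_norm; last exact: sumr_ge0.
rewrite -(rnorm_scalar_of k) -y1s.
apply: (@le_trans _ _ (rnorm (simple_int mu s))%:E).
  apply: le_trans (le_opnorm _ _) _; first by move=> a z; rewrite linearZ.
  by rewrite -[leRHS]mule1 lee_wpmul2l ?lee_fin ?rnorm_ge0.
by rewrite lee_fin simple_int_orlicz_le.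
Qed.

End dual_bound.

(** * Linearity and continuity of the integral *)

Section measurable_limit.
Context (d : measure_display) (T : measurableType d) (R : realType)
  (k : scalar_kind) (X : normedModType (scalar_field R k)).
Local Notation K := (scalar_field R k).

Lemma measurable_rnorm_simple (s : simple T X) :
  measurable_fun setT (fun t => rnorm (s t)).
Proof.
apply/measurable_EFinP.
by apply: (@simple_comp_measurable _ _ _ _ _ (fun x => (rnorm x)%:E)); rewrite rnorm0.
Qed.

(** Measurability is expressed through norms, and on the set [D] where the simple functions
    converge. *)
Lemma measurable_rnorm_lim (D : set T) (s : nat -> simple T X) (f : T -> X) :
  (forall t, D t -> s n t @[n --> \oo] --> f t) ->
  measurable_fun D (fun t => rnorm (f t)).
Proof.
move=> sf; apply: (@measurable_fun_cvg _ _ _ _ (fun n t => rnorm (s n t))).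
  by move=> n; apply: measurable_funS (measurable_rnorm_simple (s n)).
by move=> t Dt; exact: cvg_rnorm (sf t Dt).
Qed.

Lemma measurable_rnorm_dist_lim (D : set T) (s : nat -> simple T X)
    (s0 : simple T X) (f : T -> X) :
  (forall t, D t -> s n t @[n --> \oo] --> f t) ->
  measurable_fun D (fun t => rnorm (s0 t - f t)).
Proof.
move=> sf.
have /choice[u uP] : forall n, exists u : simple T X, forall t, u t = s0 t - s n t.
  move=> n; have [u [uE _]] := simple_linear (-1) (s n) s0.
  by exists u => t; rewrite uE scaleN1r addrC.
apply: (@measurable_rnorm_lim _ u) => t Dt.
under eq_cvg do rewrite uP.
by apply: cvgB; [exact: cvg_cst|exact: sf].
Qed.

End measurable_limit.

Lemma measure_null_setU (d : measure_display) (T : measurableType d)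
    (R : realType) (nu : {measure set T -> \bar R}) (A B : set T) :
  measurable A -> measurable B -> nu A = 0%E -> nu B = 0%E ->
  nu (A `|` B) = 0%E.
Proof.
move=> mA mB A0 B0; apply/eqP; rewrite eq_le measure_ge0 andbT.
apply: (@le_trans _ _ (nu A + nu B)%E); first exact: measureU2.
by rewrite A0 B0 adde0.
Qed.

(** * Linear structure of the Orlicz space *)

Section Htheta.
Context (d : measure_display) (T : measurableType d) (R : realType)
  (k : scalar_kind) (X : normedModType (scalar_field R k)).
Local Notation K := (scalar_field R k).
Variables (M : set {finite_measure set T -> \bar R}) (phi : \bar R -> \bar R).

Lemma family_measure_null (N : set T) m : family_measure M N = 0%E -> M m -> m N = 0%E.
Proof.
move=> N0 Mm; apply/eqP; rewrite eq_le measure_ge0 andbT -N0.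
exact: family_measure_ub.
Qed.

Lemma family_null_setU (A B : set T) : measurable A -> measurable B ->
  family_measure M A = 0%E -> family_measure M B = 0%E ->
  family_measure M (A `|` B) = 0%E.
Proof.
move=> mA mB A0 B0; apply/eqP; rewrite eq_le sup_over_ge0 andbT.
apply: sup_over_le => // m Mm.
by rewrite measure_null_setU//; exact: family_measure_null Mm.
Qed.

Lemma orlicz_norm_add_le (a : K) (f g : T -> X) :
  family_measurable M f -> family_measurable M g ->
  (orlicz_norm M phi (fun t => a *: f t + g t)%R <=
   (rnorm (a : K^o))%:E * orlicz_norm M phi f + orlicz_norm M phi g)%E.
Proof.
move=> [s [N [mN N0 sf]]] [s' [N' [mN' N'0 s'g]]].
apply: sup_over_le => [|m Mm].
  by rewrite adde_ge0 ?mule_ge0 ?sup_over_ge0// lee_fin rnorm_ge0.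
apply: ge_ereal_sup => _ [u uphi <-].
have mNN' : measurable (N `|` N') by exact: measurableU.
have mu0 : measurable_fun setT (fun t => rnorm (u t)).
  exact: measurable_rnorm_simple.
apply: le_trans (@integral_le_sum3 _ _ _ m (N `|` N') (rnorm (a : K^o)) _ (cst 0)
  (fun t => rnorm (u t *: f t)) (fun t => rnorm (u t *: g t))
  _ _ _ _ _ _ _ _ _ _ _) _ => //.
- by apply: measure_null_setU => //; exact: family_measure_null Mm.
- exact: rnorm_ge0.
- by move=> t; exact: rnorm_ge0.
- by move=> t; exact: rnorm_ge0.
- by move=> t; exact: rnorm_ge0.
- under eq_fun do rewrite rnormZ.
  apply: measurable_funM; first exact: measurable_funS mu0.
  by apply: measurable_rnorm_lim => t Nt; apply: sf => ?; apply: Nt; left.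
- under eq_fun do rewrite rnormZ.
  apply: measurable_funM; first exact: measurable_funS mu0.
  by apply: measurable_rnorm_lim => t Nt; apply: s'g => ?; apply: Nt; right.
- move=> t _; rewrite add0r scalerDr; apply: le_trans (ler_rnormD _ _) _.
  by rewrite scalerA mulrC -scalerA (rnormZ a).
rewrite integral0 add0e; apply: leeD.
  apply: lee_wpmul2l; first by rewrite lee_fin rnorm_ge0.
  apply: le_trans (sup_over_ub _ Mm).
  by apply: ereal_sup_ubound; exists u.
apply: le_trans (sup_over_ub _ Mm).
by apply: ereal_sup_ubound; exists u.
Qed.

Lemma family_measurable_linear (a : K) (f g : T -> X) :
  family_measurable M f -> family_measurable M g ->
  family_measurable M (fun t => a *: f t + g t).
Proof.
move=> [s [N [mN N0 sf]]] [s' [N' [mN' N'0 s'g]]].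
have /choice[u uP] : forall n, exists u : simple T X,
    forall t, u t = a *: s n t + s' n t.
  by move=> n; have [u [uE _]] := simple_linear a (s n) (s' n); exists u.
exists u, (N `|` N'); split; [exact: measurableU|exact: family_null_setU|].
move=> t Nt; under eq_cvg do rewrite uP.
apply: cvgD; last by apply: s'g => ?; apply: Nt; right.
by apply: cvgZr; apply: sf => ?; apply: Nt; left.
Qed.

Lemma Htheta_linear (a : K) (f g : T -> X) :
  Htheta M phi f -> Htheta M phi g -> Htheta M phi (fun t => a *: f t + g t).
Proof.
move=> [mf ff] [mg fg]; split; first exact: family_measurable_linear.
apply: le_lt_trans (orlicz_norm_add_le a mf mg) _.
by rewrite lte_add_pinfty// lte_mul_pinfty ?lee_fin ?rnorm_ge0.
Qed.

End Htheta.

(** * Uniqueness, linearity and size of the integral *)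

Section operator_integral.
Context (d : measure_display) (T : measurableType d) (R : realType)
  (k : scalar_kind) (X Y : normedModType (scalar_field R k)).
Local Notation K := (scalar_field R k).
Variable mu : set T -> {linear X -> Y}.
Hypothesis mu_om : operator_measure mu.

Lemma integral_le_mu_XY (y1 : {linear Y -> K^o}) (f : T -> X) :
  continuous y1 -> (opnorm y1 <= 1)%E ->
  (\int[dual_variation mu y1]_t (rnorm (f t))%:E <= mu_XY mu f)%E.
Proof. by move=> ? ?; apply: ereal_sup_ubound; exists y1. Qed.

(** Relating three functions only almost everywhere covers linearity and, with [a = 0], invariance
    under null modifications. A functional norming [w] is tested on the integrals of
    [s3 n - (a *: s1 n + s2 n)], which tend to [w] while [mu_XY] forces their images to 0. *)
Lemma has_integral_linear (a : K) (f1 f2 f3 : T -> X) v1 v2 v3 :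
  has_integral mu f1 v1 -> has_integral mu f2 v2 -> has_integral mu f3 v3 ->
  mu_ae mu (fun t => f3 t = a *: f1 t + f2 t) -> v3 = a *: v1 + v2.
Proof.
move=> [s1 [s1f [N1 [mN1 N10 sf1]]] s1v] [s2 [s2f [N2 [mN2 N20 sf2]]] s2v].
move=> [s3 [s3f [N3 [mN3 N30 sf3]]] s3v] [N [mN N0 f3E]].
apply/eqP; rewrite -subr_eq0; apply/eqP/rnorm_eq0/eqP.
rewrite eq_le rnorm_ge0 andbT.
set w := v3 - _.
have [y1 [cy1 y11 wy1]] := norming_functional w.
apply: le_trans wy1 _.
have /choice[u uP] : forall n, exists u : simple T X,
    (forall t, u t = s3 n t - (a *: s1 n t + s2 n t)) /\
    simple_int mu u =
      simple_int mu (s3 n) - (a *: simple_int mu (s1 n) + simple_int mu (s2 n)).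
  move=> n; have [u [uE ui]] := simple_linear a (s1 n) (s2 n).
  have [u' [u'E u'i]] := simple_linear (-1) u (s3 n).
  have muA := operator_measure_additive mu_om.
  exists u'; split=> [t|]; first by rewrite u'E uE scaleN1r addrC.
  by rewrite u'i// ui// scaleN1r addrC.
pose b n := (mu_XY mu (fun t => s3 n t - f3 t)%R +
  (rnorm (a : K^o))%:E * mu_XY mu (fun t => s1 n t - f1 t)%R +
  mu_XY mu (fun t => s2 n t - f2 t)%R)%E.
have b0 : b n @[n --> \oo] --> 0%E.
  have c1 : ((rnorm (a : K^o))%:E * mu_XY mu (fun t => s1 n t - f1 t)%R)%E
      @[n --> \oo] --> 0%E.
    by rewrite -[X in _ --> X](mule0 (rnorm (a : K^o))%:E); exact: cvgeZl.
  rewrite [X in _ --> X](_ : _ = 0 + 0 + 0)%E; last by rewrite !adde0.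
  apply: cvgeD; [by rewrite adde0| |exact: s2f].
  by apply: cvgeD; [|exact: s3f|exact: c1].
pose N' := N `|` N1 `|` N2 `|` N3.
have mN' : measurable N' by do 3?apply: measurableU.
have ub n : ((rnorm (y1 (simple_int mu (u n))))%:E <= b n)%E.
  apply: le_trans (simple_int_le mu_om cy1 (u n)) _.
  pose nu := dual_variation_measure mu_om cy1.
  apply: (@le_trans _ _ (\int[nu]_t (rnorm (s3 n t - f3 t))%:E +
    (rnorm (a : K^o))%:E * \int[nu]_t (rnorm (s1 n t - f1 t))%:E +
    \int[nu]_t (rnorm (s2 n t - f2 t))%:E)%E); last first.
    apply: leeD; last exact: integral_le_mu_XY.
    apply: leeD; first exact: integral_le_mu_XY.
    by apply: lee_wpmul2l; [rewrite lee_fin rnorm_ge0|exact: integral_le_mu_XY].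
  apply: (@integral_le_sum3 _ _ _ nu N') => //; try by (move=> *; exact: rnorm_ge0).
  - have n1 : nu (N `|` N1) = 0%E.
      by apply: measure_null_setU => //; [exact: N0|exact: N10].
    have n2 : nu (N `|` N1 `|` N2) = 0%E.
      by apply: measure_null_setU => //; [exact: measurableU|exact: N20].
    by apply: measure_null_setU => //; [do 2?apply: measurableU|exact: N30].
  - by apply: measurable_rnorm_dist_lim => t Nt; apply: sf3 => ?; apply: Nt; right.
  - apply: measurable_rnorm_dist_lim => t Nt; apply: sf1 => ?; apply: Nt.
    by left; left; right.
  - apply: measurable_rnorm_dist_lim => t Nt; apply: sf2 => ?; apply: Nt.
    by left; right.
  move=> t Nt; rewrite (uP n).1 -rnormZ.
  have E : f3 t = a *: f1 t + f2 t by apply: f3E => ?; apply: Nt; do 3!left.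
  (* Off [N'] the limits cancel, since [f3 = a *: f1 + f2], and only the three approximation errors
     remain. *)
  rewrite (_ : _ - _ = (s3 n t - f3 t) + - (a *: (s1 n t - f1 t)) +
      - (s2 n t - f2 t)); last first.
    rewrite E scalerBr !opprB -[RHS]addrA (addrACA (a *: f1 t)) -opprD.
    by rewrite [RHS]addrA subrK.
  apply: le_trans (ler_rnormD _ _) _; rewrite rnormN lerD2r.
  by apply: le_trans (ler_rnormD _ _) _; rewrite rnormN.
have uw : simple_int mu (u n) @[n --> \oo] --> w.
  under eq_cvg do rewrite (uP _).2.
  by apply: cvgB => //; apply: cvgD => //; exact: cvgZr.
have yw : (rnorm (y1 (simple_int mu (u n))))%:E @[n --> \oo] --> (rnorm (y1 w))%:E.
  apply: cvg_EFin; first by near=> n.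
  by apply: cvg_rnorm; apply: continuous_cvg => //; exact: cy1.
have bl := cvg_lim (@ereal_hausdorff R) b0.
rewrite -lee_fin -(cvg_lim _ yw)// -[leRHS]bl.
apply: lee_lim; [by apply/cvg_ex; eexists; exact: yw|by apply/cvg_ex; eexists; exact: b0|].
exact: nearW.
Unshelve. all: by end_near. Qed.

(** For a functional norming [v], the norm of [s n] is split into that of [s n - f], whose integral
    tends to 0, and that of [f]. *)
Lemma has_integral_le (f : T -> X) v (B : R) :
  has_integral mu f v -> (mu_XY mu f <= B%:E)%E -> rnorm v <= B.
Proof.
move=> [s [sf [N [mN N0 sNf]]] sv] fB.
have [y1 [cy1 y11 wy1]] := norming_functional v.
apply: le_trans wy1 _.
pose b n := (mu_XY mu (fun t => s n t - f t)%R + B%:E)%E.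
have b0 : b n @[n --> \oo] --> B%:E.
  rewrite [X in _ --> X](_ : _ = 0 + B%:E)%E; last by rewrite add0e.
  by apply: cvgeD => //; exact: cvg_cst.
have ub n : ((rnorm (y1 (simple_int mu (s n))))%:E <= b n)%E.
  apply: le_trans (simple_int_le mu_om cy1 (s n)) _.
  pose nu := dual_variation_measure mu_om cy1.
  apply: (@le_trans _ _ (\int[nu]_t (rnorm (s n t - f t))%:E +
    0%:E * \int[nu]_t (cst 0 t)%:E + \int[nu]_t (rnorm (f t))%:E)%E); last first.
    rewrite mul0e adde0; apply: leeD; first exact: integral_le_mu_XY.
    by apply: le_trans fB; exact: integral_le_mu_XY.
  apply: (@integral_le_sum3 _ _ _ nu N) => //; try by (move=> *; exact: rnorm_ge0).
  - exact: N0.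
  - by apply: measurable_rnorm_dist_lim => t Nt; apply: sNf.
  - by apply: measurable_rnorm_lim => t Nt; apply: sNf.
  - move=> t _; rewrite mul0r addr0; apply: le_trans (ler_rnormD _ _).
    by rewrite subrK.
have yw : (rnorm (y1 (simple_int mu (s n))))%:E @[n --> \oo] --> (rnorm (y1 v))%:E.
  apply: cvg_EFin; first by near=> n.
  by apply: cvg_rnorm; apply: continuous_cvg => //; exact: cy1.
have bl := cvg_lim (@ereal_hausdorff R) b0.
rewrite -lee_fin -(cvg_lim _ yw)// -[leRHS]bl.
apply: lee_lim; [by apply/cvg_ex; eexists; exact: yw|by apply/cvg_ex; eexists; exact: b0|].
exact: nearW.
Unshelve. all: by end_near. Qed.

End operator_integral.

Theorem theorem3p4 (R : realType) (k : scalar_kind)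
    (X Y : completeNormedModType (scalar_field R k))
    (d : measure_display) (T : measurableType d)
    (M : set {finite_measure set T -> \bar R})
    (theta phi : \bar R -> \bar R)
    (mu : set T -> {linear X -> Y}) (Delta : (T -> X) -> Y) :
  sigma_bounded M ->
  relatively_weakly_compact (@measure_ca d T R k @` M) ->
  conjugate_young theta phi ->
  operator_measure mu ->
  (semivariation M theta mu [set: T] < +oo)%E ->
  (forall f : T -> X, Htheta M phi f -> has_integral mu f (Delta f)) ->
  [/\ forall f g : T -> X, Htheta M phi f -> Htheta M phi g ->
        family_ae M (fun t => f t = g t) -> Delta f = Delta g,
      forall (a : scalar_field R k) (f g : T -> X),
        Htheta M phi f -> Htheta M phi g ->
        Htheta M phi (fun t => a *: f t + g t) /\
        Delta (fun t => a *: f t + g t) = a *: Delta f + Delta g &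
      forall f : T -> X, Htheta M phi f -> forall e : R, 0 < e ->
        exists2 delta : R, 0 < delta & forall g : T -> X, Htheta M phi g ->
          (orlicz_norm M phi (fun t => g t - f t)%R < delta%:E)%E ->
          rnorm (Delta g - Delta f) < e].
Proof.
move=> sbM _ cyoung mu_om sv hasD.
have [C C0 svC] : exists2 C : R, 0 <= C & (semivariation M theta mu [set: T] <= C%:E)%E.
  case: (semivariation _ _ _ _) sv => [r _|//|_]; last by exists 0; rewrite ?leNye.
  by exists `|r|; rewrite ?normr_ge0// lee_fin ler_norm.
have lin (a : scalar_field R k) (f g : T -> X) : Htheta M phi f -> Htheta M phi g ->
    Htheta M phi (fun t => a *: f t + g t) /\
    Delta (fun t => a *: f t + g t) = a *: Delta f + Delta g.
  move=> Hf Hg; have Hfg := Htheta_linear a Hf Hg; split=> //.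
  apply: (has_integral_linear mu_om (hasD _ Hf) (hasD _ Hg) (hasD _ Hfg)).
  exists set0; split=> // y1 cy1.
  by rewrite -(dual_variation_measureE mu_om cy1) measure0.
split=> // [f g Hf Hg [N [mN N0 fg]]|f Hf e e0].
  (* The case [f3 = f], [f2 = g] with coefficient 0: the null set for [M] is null for every dual
     variation. *)
  have := has_integral_linear mu_om (a := 0) (hasD _ Hf) (hasD _ Hg) (hasD _ Hf).
  rewrite scale0r add0r; apply; exists N; split=> // [y1 _|t Nt].
    exact: (dual_variation_null cyoung C0 svC).
  by rewrite scale0r add0r fg.
have C10 : 0 < C + 1 by rewrite ltr_wpDl.
(* The final bound is [2 * l * C = e * (C / (C + 1))], strictly below [e]; adding 1 keeps the
   denominator positive when [C] is 0. *)
exists (e / (2 * (C + 1))) => [|g Hg]; first by rewrite divr_gt0// mulr_gt0.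
set l := e / _ => gfl.
have l0 : 0 < l by rewrite divr_gt0// mulr_gt0.
have [Hh Dh] := lin (-1) f g Hf Hg.
have hE : (fun t => -1 *: f t + g t) = (fun t => g t - f t).
  by apply/funext => t; rewrite scaleN1r addrC.
have -> : Delta g - Delta f = Delta (fun t => g t - f t).
  by rewrite -hE Dh scaleN1r addrC.
rewrite hE in Hh.
apply: (@le_lt_trans _ _ (2 * l * C)); last first.
  rewrite (_ : 2 * l * C = e * (C / (C + 1))); last first.
    by rewrite /l; field; rewrite gt_eqF.
  by rewrite gtr_pMr// ltr_pdivrMr// mul1r ltrDl.
apply: (has_integral_le mu_om (hasD _ Hh)).
apply: ge_ereal_sup => _ [y1 [cy1 y11] <-].
by apply: (dual_integral_le sbM cyoung mu_om svC) => //; exact: ltW.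
Qed.
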